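(* Consider a first-order system of ordinary differential equations in two real dependent variables $u,v$, $$\frac{\mathrm{d} u}{\mathrm{d} t}=\Theta(t,u,v),\qquad \frac{\mathrm{d} v}{\mathrm{d} t}=\Omega(t,u,v),$$ and suppose that the associated $t$-dependent vector field $$\mathbf{X}=\Theta(t,u,v)\frac{\partial}{\partial u}+\Omega(t,u,v)\frac{\partial}{\partial v}$$ admits a decomposition $\mathbf{X}= f(t)\mathbf{X}_1+g(t)\mathbf{X}_2$ for some functions $f(t),g(t)$ and vector fields $\mathbf{X}_1,\mathbf{X}_2$ on the plane satisfying $$\frac{\partial \mathbf{X}_1}{\partial t}=\frac{\partial \mathbf{X}_2}{\partial t}=0,\qquad \left[\mathbf{X}_1,\mathbf{X}_2\right]=\lambda \mathbf{X}_1+\mu\mathbf{X}_2\neq 0,$$ where $\lambda,\mu$ are constants. Then the system can be solved by quadratures.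
   Context: All functions and vector fields are real and smooth, and all considerations are local, around generic points of the $(u,v)$-plane. The condition $\partial\mathbf{X}_i/\partial t=0$ means that the coefficients of $\mathbf{X}_i$ depend only on $(u,v)$. A system is said to be solvable by quadratures if, after a suitable (local) $t$-independent diffeomorphism of the dependent variables, its general solution can be written in terms of the $t$-dependent coefficient functions by means of finitely many algebraic operations, compositions with elementary functions and integrations with respect to $t$; the property is regarded as invariant under local diffeomorphisms of the dependent variables. The model system is $\dot x=b_A(t)x$, $\dot y=-b_A(t)y+b_B(t)$. *)

(* Defs.v *)
From Stdlib Require Import Reals.
From Coquelicot Require Import Coquelicot.

Open Scope R_scope.

(** * Smoothness *)

Definition is_open_interval (T : R -> Prop) : Prop :=
  open T /\ (forall a b s, T a -> T b -> a <= s <= b -> T s).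

Definition smooth1_on (T : R -> Prop) (f : R -> R) : Prop :=
  forall n t, T t -> ex_derive_n f n t.

(* [ex_diff_n F n x y] only asserts pointwise existence and continuity of the
   partial derivatives up to order [n]; on an open [U] this is C^oo. *)
Definition smooth2_on (U : R * R -> Prop) (F : R -> R -> R) : Prop :=
  forall n x y, U (x, y) -> ex_diff_n F n x y.

(** * Vector fields on the plane *)

(* A t-independent field  cu d/du + cv d/dv : the condition dX/dt = 0 is
   expressed by the coefficients having no time argument. *)
Record vfield := VField { cu : R -> R -> R; cv : R -> R -> R }.

Definition smooth_vfield (U : R * R -> Prop) (X : vfield) : Prop :=
  smooth2_on U (cu X) /\ smooth2_on U (cv X).

Definition dd_u (F : R -> R -> R) (u v : R) : R := Derive (fun z => F z v) u.
Definition dd_v (F : R -> R -> R) (u v : R) : R := Derive (fun z => F u z) v.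

Definition lie_derivative (X : vfield) (F : R -> R -> R) (u v : R) : R :=
  cu X u v * dd_u F u v + cv X u v * dd_v F u v.

Definition bracket (X Y : vfield) : vfield :=
  VField
    (fun u v => lie_derivative X (cu Y) u v - lie_derivative Y (cu X) u v)
    (fun u v => lie_derivative X (cv Y) u v - lie_derivative Y (cv X) u v).

Definition lin_comb (a : R) (X : vfield) (b : R) (Y : vfield) : vfield :=
  VField (fun u v => a * cu X u v + b * cu Y u v)
         (fun u v => a * cv X u v + b * cv Y u v).

Definition eq_vfield_on (U : R * R -> Prop) (X Y : vfield) : Prop :=
  forall u v, U (u, v) -> cu X u v = cu Y u v /\ cv X u v = cv Y u v.

Definition zero_vfield : vfield := VField (fun _ _ => 0) (fun _ _ => 0).

(** * Local diffeomorphisms of the plane *)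

Definition maps_to (phi1 phi2 : R -> R -> R) (V W : R * R -> Prop) : Prop :=
  forall u v, V (u, v) -> W (phi1 u v, phi2 u v).

Definition left_inverse_on (V : R * R -> Prop)
    (phi1 phi2 psi1 psi2 : R -> R -> R) : Prop :=
  forall u v, V (u, v) ->
    psi1 (phi1 u v) (phi2 u v) = u /\ psi2 (phi1 u v) (phi2 u v) = v.

Definition diffeomorphism (V W : R * R -> Prop) (phi1 phi2 : R -> R -> R) : Prop :=
  open V /\ open W /\
  exists psi1 psi2 : R -> R -> R,
    smooth2_on V phi1 /\ smooth2_on V phi2 /\
    smooth2_on W psi1 /\ smooth2_on W psi2 /\
    maps_to phi1 phi2 V W /\ maps_to psi1 psi2 W V /\
    left_inverse_on V phi1 phi2 psi1 psi2 /\
    left_inverse_on W psi1 psi2 phi1 phi2.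

(** * Expressions by quadratures *)

(* Powers with real exponent and roots of positive functions need no symbol of
   their own: they are exp (a * ln e). *)
Inductive elementary := EExp | ELn | ESqrt | ESin | ECos | ETan | EAsin | EAcos | EAtan.

Definition elem_fun (h : elementary) : R -> R :=
  match h with
  | EExp => exp | ELn => ln | ESqrt => sqrt
  | ESin => sin | ECos => cos | ETan => tan
  | EAsin => asin | EAcos => acos | EAtan => atan
  end.

(* The Stdlib functions are total; this is where they have their usual meaning. *)
Definition elem_dom (h : elementary) (x : R) : Prop :=
  match h with
  | ELn => 0 < x
  | ESqrt => 0 <= x
  | ETan => cos x <> 0
  | EAsin | EAcos => -1 <= x <= 1
  | EExp | ESin | ECos | EAtan => True
  end.

(* Expressions in two coefficient functions of t and two constants of
   integration. *)
Inductive qexpr :=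
  | QCoef1 | QCoef2
  | QIntConst1 | QIntConst2
  | QReal (r : R)
  | QAdd (e1 e2 : qexpr) | QSub (e1 e2 : qexpr)
  | QMul (e1 e2 : qexpr) | QDiv (e1 e2 : qexpr)
  | QElem (h : elementary) (e : qexpr)
  | QInt (e : qexpr).

(* [QInt e] is the integral of [e] from the initial time [t0] to [t]. *)
Fixpoint qeval (f g : R -> R) (t0 c1 c2 : R) (e : qexpr) (t : R) : R :=
  match e with
  | QCoef1 => f t
  | QCoef2 => g t
  | QIntConst1 => c1
  | QIntConst2 => c2
  | QReal r => r
  | QAdd a b => qeval f g t0 c1 c2 a t + qeval f g t0 c1 c2 b t
  | QSub a b => qeval f g t0 c1 c2 a t - qeval f g t0 c1 c2 b t
  | QMul a b => qeval f g t0 c1 c2 a t * qeval f g t0 c1 c2 b t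
  | QDiv a b => qeval f g t0 c1 c2 a t / qeval f g t0 c1 c2 b t
  | QElem h a => elem_fun h (qeval f g t0 c1 c2 a t)
  | QInt a => RInt (qeval f g t0 c1 c2 a) t0 t
  end.

(* [qeval] is total, so junk values (division by zero, integrals of
   non-integrable functions, ...) have to be excluded. *)
Fixpoint qdefined (f g : R -> R) (t0 c1 c2 : R) (e : qexpr) (t : R) : Prop :=
  match e with
  | QCoef1 | QCoef2 | QIntConst1 | QIntConst2 | QReal _ => True
  | QAdd a b | QSub a b | QMul a b =>
      qdefined f g t0 c1 c2 a t /\ qdefined f g t0 c1 c2 b t
  | QDiv a b =>
      qdefined f g t0 c1 c2 a t /\ qdefined f g t0 c1 c2 b t /\
      qeval f g t0 c1 c2 b t <> 0
  | QElem h a =>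
      qdefined f g t0 c1 c2 a t /\ elem_dom h (qeval f g t0 c1 c2 a t)
  | QInt a =>
      (forall s, Rmin t0 t <= s <= Rmax t0 t -> qdefined f g t0 c1 c2 a s) /\
      ex_RInt (qeval f g t0 c1 c2 a) t0 t
  end.

(** * Systems and their solvability by quadratures *)

Definition solution_on (Theta Omega : R -> R -> R -> R) (J : R -> Prop)
    (u v : R -> R) : Prop :=
  forall t, J t ->
    is_derive u t (Theta t (u t) (v t)) /\ is_derive v t (Omega t (u t) (v t)).

(* In the coordinates (phi1, phi2) on V, the solutions of the system are exactly
   the curves t |-> (e1, e2)(t; c1, c2), with [e1] and [e2] independent of the
   solution. Solutions are taken on arbitrary open subintervals J of T, with an
   arbitrary initial time t0 in J as base point of the integrals. *)
Definition general_solution (f g : R -> R) (T : R -> Prop)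
    (Theta Omega : R -> R -> R -> R) (V : R * R -> Prop)
    (phi1 phi2 : R -> R -> R) (e1 e2 : qexpr) : Prop :=
  forall (J : R -> Prop) (t0 : R),
    is_open_interval J -> (forall t, J t -> T t) -> J t0 ->
    forall u v : R -> R,
      (forall t, J t -> V (u t, v t)) ->
      (solution_on Theta Omega J u v <->
       exists c1 c2 : R, forall t, J t ->
         qdefined f g t0 c1 c2 e1 t /\ qdefined f g t0 c1 c2 e2 t /\
         phi1 (u t) (v t) = qeval f g t0 c1 c2 e1 t /\
         phi2 (u t) (v t) = qeval f g t0 c1 c2 e2 t).

Definition solvable_by_quadratures_at (f g : R -> R) (T : R -> Prop)
    (U : R * R -> Prop) (Theta Omega : R -> R -> R -> R) (p : R * R) : Prop :=
  exists (V W : R * R -> Prop) (phi1 phi2 : R -> R -> R) (e1 e2 : qexpr),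
    V p /\ (forall q, V q -> U q) /\
    diffeomorphism V W phi1 phi2 /\
    general_solution f g T Theta Omega V phi1 phi2 e1 e2.

(* Generic points of U: those of some open dense subset of U. *)
Definition solvable_by_quadratures (f g : R -> R) (T : R -> Prop)
    (U : R * R -> Prop) (Theta Omega : R -> R -> R -> R) : Prop :=
  exists G : R * R -> Prop,
    open G /\ (forall p, G p -> U p) /\
    (forall q, U q -> forall eps : posreal, exists p, G p /\ ball q eps p) /\
    (forall p, G p -> solvable_by_quadratures_at f g T U Theta Omega p).

(* Main.v *)
Require Import Defs.
From Stdlib Require Import Reals Lra Psatz Classical ClassicalEpsilon Ranalysis5.
From Coquelicot Require Import Coquelicot.

(** Since [(lambda, mu) <> 0], constant combinations [A], [B] of [X1], [X2]
    satisfy [[A, B] = B], and the system is [a(t) A + b(t) B] with [a], [b]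
    constant combinations of [f], [g]. It suffices to find local coordinates
    whose derivatives along [A] and [B] are affine functions of themselves with
    constant coefficients: each coordinate then satisfies a scalar linear equation.
    Such coordinates exist near a dense set of points:
    - if [A], [B] are independent, dual closed forms give [A x = 1], [B x = 0],
      [A y = - y], [B y = 1], the model system;
    - if [A = h B] on an open set and [B <> 0], then [B h = - 1] and the
      coordinates are [h] and a first integral [k] of [B];
    - if [B = 0] on an open set and [A <> 0], one rectifies [A];
    - if [A = B = 0] on an open set, any coordinates will do.

    A first integral of a plane field is obtained by inverting [c |-> V u c], where
    [V] solves [dv/du = beta u v], [V u0 c = c]. This equation being scalar, the
    derivative of [V] in [c] is [exp] of the integral of [dd_v beta] along the
    solution, so continuity of [V] bootstraps to smoothness. *)

(** * Functions with continuous partial derivatives up to a given order *)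

(** The affine form is the common target because it survives constant linear combinations: if [A]
    and [B] act affinely on a coordinate, so do [X1] and [X2]. Along a solution that coordinate then
    satisfies y' = q y + r, with q, r constant combinations of [f], [g], and variation of constants
    is an expression by quadratures whose constant of integration is the value at [t0]. The
    degenerate cases cannot be avoided: the hypothesis only says that the bracket is not identically
    zero on [U], and a smooth field may still vanish on an open subset. Hence only density is
    claimed: in a given open set each nondegeneracy condition either holds at some point, or fails
    identically, and then the resulting identity may be differentiated. Smoothness is given as
    existence and continuity of iterated partial derivatives at points, whereas curves, inverses and
    compositions need the chain rule. The bridge is total differentiability, recovered from
    continuous partials on open sets. *)

Definition Ck (n : nat) (D : R * R -> Prop) (F : R -> R -> R) : Prop :=
  forall x y, D (x, y) -> ex_diff_n F n x y.

Lemma smooth2_Ck D F : smooth2_on D F <-> forall n, Ck n D F.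
Proof. split; intros H n; [intros x y|intros x y Hxy]; apply H; assumption. Qed.

Lemma open_locally_2d (D : R * R -> Prop) x y :
  open D -> D (x, y) -> locally_2d (fun u v => D (u, v)) x y.
Proof.
  intros HD Hxy. apply locally_2d_locally.
  apply filter_imp with (2 := HD _ Hxy). now intros [u v].
Qed.

Lemma Ck_le n m D F : (m <= n)%nat -> Ck n D F -> Ck m D F.
Proof. intros Hmn HF x y Hxy. apply ex_diff_n_m with (1 := Hmn). auto. Qed.

Lemma Ck_ext n D F G : open D -> (forall x y, D (x, y) -> F x y = G x y) ->
  Ck n D F -> Ck n D G.
Proof.
  intros HD HFG HF x y Hxy. apply ex_diff_n_ext_loc with F; [|auto].
  apply locally_2d_impl with (2 := open_locally_2d D x y HD Hxy).
  apply locally_2d_forall. intros; auto.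
Qed.

Lemma Ck_subset n (D D' : R * R -> Prop) F :
  (forall q, D' q -> D q) -> Ck n D F -> Ck n D' F.
Proof. intros H HF x y Hxy. auto. Qed.

Lemma Ck_continuous n D F x y : Ck n D F -> D (x, y) -> continuity_2d_pt F x y.
Proof. intros HF Hxy. specialize (HF x y Hxy). destruct n; apply HF. Qed.

Lemma Ck_is_derive_u n D F x y : Ck (S n) D F -> D (x, y) ->
  is_derive (fun z => F z y) x (dd_u F x y).
Proof. intros HF Hxy. apply Derive_correct. apply (HF x y Hxy). Qed.

Lemma Ck_is_derive_v n D F x y : Ck (S n) D F -> D (x, y) ->
  is_derive (fun z => F x z) y (dd_v F x y).
Proof. intros HF Hxy. apply Derive_correct. apply (HF x y Hxy). Qed.

Lemma Ck_dd_u n D F : Ck (S n) D F -> Ck n D (dd_u F).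
Proof. intros HF x y Hxy. apply (HF x y Hxy). Qed.

Lemma Ck_dd_v n D F : Ck (S n) D F -> Ck n D (dd_v F).
Proof. intros HF x y Hxy. apply (HF x y Hxy). Qed.

(** The increment is split into a step in the first variable, uniformly controlled by continuity of
    [Fu], and a step in the second at fixed [x], where the derivative at the point suffices. *)
Lemma differentiable_of_partials (D : R * R -> Prop) F Fu Fv x y :
  open D -> D (x, y) ->
  (forall x y, D (x, y) -> is_derive (fun z => F z y) x (Fu x y)) ->
  (forall x y, D (x, y) -> is_derive (fun z => F x z) y (Fv x y)) ->
  Ck 0 D Fu -> differentiable_pt_lim F x y (Fu x y) (Fv x y).
Proof.
  intros HD Hxy Hu Hv Cu Cv.
  apply filterdiff_differentiable_pt_lim.
  apply (is_derive_filterdiff F x y Fu (Fv x y)).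
  - apply filter_imp with (2 := HD _ Hxy). intros [u v] Huv. now apply Hu.
  - now apply Hv.
  - apply continuity_2d_pt_filterlim. now apply Cu.
Qed.

Lemma differentiable_is_derive_u F x y lx ly :
  differentiable_pt_lim F x y lx ly -> is_derive (fun z => F z y) x lx.
Proof.
  intros H. apply is_derive_Reals.
  replace lx with (lx * 1 + ly * 0) by ring.
  apply (derivable_pt_lim_comp_2d F (fun z => z) (fun _ => y)); [exact H|..].
  - apply derivable_pt_lim_id.
  - apply derivable_pt_lim_const.
Qed.

Lemma differentiable_is_derive_v F x y lx ly :
  differentiable_pt_lim F x y lx ly -> is_derive (fun z => F x z) y ly.
Proof.
  intros H. apply is_derive_Reals.
  replace ly with (lx * 0 + ly * 1) by ring.
  apply (derivable_pt_lim_comp_2d F (fun _ => x) (fun z => z)); [exact H|..].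
  - apply derivable_pt_lim_const.
  - apply derivable_pt_lim_id.
Qed.

(** The inductive step of the closure properties below: explicit partial derivatives one order lower
    are enough. *)
Lemma Ck_intro n D F Fu Fv : open D ->
  (forall x y, D (x, y) -> is_derive (fun z => F z y) x (Fu x y)) ->
  (forall x y, D (x, y) -> is_derive (fun z => F x z) y (Fv x y)) ->
  Ck n D Fu -> Ck n D Fv -> Ck (S n) D F.
Proof.
  intros HD Hu Hv Cu Cv x y Hxy. split; [|split; [|split; [|split]]].
  - apply differentiable_continuity_pt. exists (Fu x y), (Fv x y).
    apply differentiable_of_partials with D; auto.
    apply Ck_le with n; auto with arith.
  - eexists. now apply Hu.
  - eexists. now apply Hv.
  - apply (Ck_ext n D Fu); auto. intros a b Hab. symmetry. apply is_derive_unique. now apply Hu.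
  - apply (Ck_ext n D Fv); auto. intros a b Hab. symmetry. apply is_derive_unique. now apply Hv.
Qed.

Lemma Ck_differentiable n D F x y : open D -> Ck (S n) D F -> D (x, y) ->
  differentiable_pt_lim F x y (dd_u F x y) (dd_v F x y).
Proof.
  intros HD HF Hxy. apply differentiable_of_partials with D; auto.
  - intros. now apply Ck_is_derive_u with n D.
  - intros. now apply Ck_is_derive_v with n D.
  - apply Ck_dd_u, Ck_le with (S n); auto with arith.
Qed.

(** The variant for compositions and inverse maps, where the chain rule delivers both partials in
    one total derivative. *)
Lemma Ck_intro_differentiable n D F Fu Fv : open D ->
  (forall x y, D (x, y) -> differentiable_pt_lim F x y (Fu x y) (Fv x y)) ->
  Ck n D Fu -> Ck n D Fv -> Ck (S n) D F.
Proof.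
  intros HD H. apply Ck_intro; auto.
  - intros x y Hxy. apply differentiable_is_derive_u with (Fv x y); auto.
  - intros x y Hxy. apply differentiable_is_derive_v with (Fu x y); auto.
Qed.

Lemma Ck_const n D c : open D -> Ck n D (fun _ _ => c).
Proof.
  intros HD. revert c. induction n as [|n IH]; intros c.
  - intros x y _. split; [apply continuity_2d_pt_const|exact I].
  - apply Ck_intro with (fun _ _ => 0) (fun _ _ => 0); auto; intros; apply @is_derive_const.
Qed.

Lemma Ck_fst n D : open D -> Ck n D (fun u _ => u).
Proof.
  intros HD. destruct n as [|n].
  - intros x y _. split; [apply continuity_2d_pt_id1|exact I].
  - apply Ck_intro with (fun _ _ => 1) (fun _ _ => 0); auto using Ck_const; intros.
    + apply @is_derive_id.
    + apply @is_derive_const.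
Qed.

Lemma Ck_snd n D : open D -> Ck n D (fun _ v => v).
Proof.
  intros HD. destruct n as [|n].
  - intros x y _. split; [apply continuity_2d_pt_id2|exact I].
  - apply Ck_intro with (fun _ _ => 0) (fun _ _ => 1); auto using Ck_const; intros.
    + apply @is_derive_const.
    + apply @is_derive_id.
Qed.

Lemma Ck_plus n D F G : open D -> Ck n D F -> Ck n D G ->
  Ck n D (fun u v => F u v + G u v).
Proof.
  intros HD. revert F G. induction n as [|n IH]; intros F G HF HG.
  - intros x y Hxy. split; [|exact I].
    apply continuity_2d_pt_plus; eapply Ck_continuous; eauto.
  - apply Ck_intro with (fun u v => dd_u F u v + dd_u G u v)
      (fun u v => dd_v F u v + dd_v G u v); auto using Ck_dd_u, Ck_dd_v; intros x y Hxy.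
    + apply @is_derive_plus; eapply Ck_is_derive_u; eauto.
    + apply @is_derive_plus; eapply Ck_is_derive_v; eauto.
Qed.

Lemma Ck_mult n D F G : open D -> Ck n D F -> Ck n D G ->
  Ck n D (fun u v => F u v * G u v).
Proof.
  intros HD. revert F G. induction n as [|n IH]; intros F G HF HG.
  - intros x y Hxy. split; [|exact I].
    apply continuity_2d_pt_mult; eapply Ck_continuous; eauto.
  - assert (HF' : Ck n D F) by (apply Ck_le with (S n); auto).
    assert (HG' : Ck n D G) by (apply Ck_le with (S n); auto).
    apply Ck_intro with (fun u v => dd_u F u v * G u v + F u v * dd_u G u v)
      (fun u v => dd_v F u v * G u v + F u v * dd_v G u v);
      auto using Ck_dd_u, Ck_dd_v, Ck_plus; intros x y Hxy.
    + apply (Derive.is_derive_mult (fun z => F z y) (fun z => G z y)); eapply Ck_is_derive_u; eauto.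
    + apply (Derive.is_derive_mult (F x) (G x)); eapply Ck_is_derive_v; eauto.
Qed.

Lemma Ck_opp n D F : open D -> Ck n D F -> Ck n D (fun u v => - F u v).
Proof.
  intros HD HF. apply Ck_ext with (fun u v => (-1) * F u v); auto.
  - intros; ring.
  - apply Ck_mult; auto using Ck_const.
Qed.

Lemma Ck_minus n D F G : open D -> Ck n D F -> Ck n D G ->
  Ck n D (fun u v => F u v - G u v).
Proof. intros. apply Ck_plus; auto using Ck_opp. Qed.

Lemma Ck_exp n D F : open D -> Ck n D F -> Ck n D (fun u v => exp (F u v)).
Proof.
  intros HD. induction n as [|n IH]; intros HF.
  - intros x y Hxy. split; [|exact I].
    apply continuity_1d_2d_pt_comp.
    + apply derivable_continuous_pt, derivable_pt_exp.
    + eapply Ck_continuous; eauto.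
  - assert (HF' : Ck n D F) by (apply Ck_le with (S n); auto).
    apply Ck_intro with (fun u v => dd_u F u v * exp (F u v))
      (fun u v => dd_v F u v * exp (F u v));
      auto using Ck_mult, Ck_dd_u, Ck_dd_v; intros x y Hxy.
    + apply (is_derive_comp exp); [apply is_derive_exp|eapply Ck_is_derive_u; eauto].
    + apply (is_derive_comp exp); [apply is_derive_exp|eapply Ck_is_derive_v; eauto].
Qed.

Lemma Ck_inv n D F : open D -> (forall x y, D (x, y) -> F x y <> 0) ->
  Ck n D F -> Ck n D (fun u v => / F u v).
Proof.
  intros HD H0. induction n as [|n IH]; intros HF.
  - intros x y Hxy. split; [|exact I].
    apply continuity_2d_pt_inv; auto. eapply Ck_continuous; eauto.
  - assert (HF' : Ck n D F) by (apply Ck_le with (S n); auto).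
    apply Ck_intro with (fun u v => - dd_u F u v * (/ F u v * / F u v))
      (fun u v => - dd_v F u v * (/ F u v * / F u v));
      auto using Ck_mult, Ck_opp, Ck_dd_u, Ck_dd_v; intros x y Hxy.
    + replace (- dd_u F x y * (/ F x y * / F x y)) with (- dd_u F x y / F x y ^ 2)
        by (field; auto).
      apply (is_derive_inv (fun z => F z y)); auto. eapply Ck_is_derive_u; eauto.
    + replace (- dd_v F x y * (/ F x y * / F x y)) with (- dd_v F x y / F x y ^ 2)
        by (field; auto).
      apply (is_derive_inv (F x)); auto. eapply Ck_is_derive_v; eauto.
Qed.

Lemma Ck_div n D F G : open D -> (forall x y, D (x, y) -> G x y <> 0) ->
  Ck n D F -> Ck n D G -> Ck n D (fun u v => F u v / G u v).
Proof. intros. apply Ck_mult; auto using Ck_inv. Qed.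

Lemma continuity_2d_pt_comp F G1 G2 x y :
  continuity_2d_pt F (G1 x y) (G2 x y) ->
  continuity_2d_pt G1 x y -> continuity_2d_pt G2 x y ->
  continuity_2d_pt (fun u v => F (G1 u v) (G2 u v)) x y.
Proof.
  intros HF H1 H2 eps. destruct (HF eps) as [d Hd].
  apply locally_2d_impl with (2 := locally_2d_and _ _ _ _ (H1 d) (H2 d)).
  apply locally_2d_forall. intros u v [? ?]. now apply Hd.
Qed.

Lemma Ck_comp n D E F G1 G2 : open D -> open E ->
  (forall x y, D (x, y) -> E (G1 x y, G2 x y)) ->
  Ck n E F -> Ck n D G1 -> Ck n D G2 -> Ck n D (fun u v => F (G1 u v) (G2 u v)).
Proof.
  (* The induction hypothesis is needed for [dd_u F] and [dd_v F], while the inner maps stay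
     fixed. *)
  intros HD HE HG. revert F. induction n as [|n IH]; intros F HF H1 H2.
  - intros x y Hxy. split; [|exact I].
    apply continuity_2d_pt_comp; eapply Ck_continuous; eauto.
  - assert (H1' : Ck n D G1) by (apply Ck_le with (S n); auto).
    assert (H2' : Ck n D G2) by (apply Ck_le with (S n); auto).
    apply Ck_intro_differentiable with
      (fun u v => dd_u F (G1 u v) (G2 u v) * dd_u G1 u v
                  + dd_v F (G1 u v) (G2 u v) * dd_u G2 u v)
      (fun u v => dd_u F (G1 u v) (G2 u v) * dd_v G1 u v
                  + dd_v F (G1 u v) (G2 u v) * dd_v G2 u v);
      auto 7 using Ck_plus, Ck_mult, Ck_dd_u, Ck_dd_v.
    intros x y Hxy. apply differentiable_pt_lim_comp;
      [apply Ck_differentiable with n E|apply Ck_differentiable with n D..]; auto.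
Qed.

Definition swap (D : R * R -> Prop) : R * R -> Prop := fun q => D (snd q, fst q).

Lemma open_swap D : open D -> open (swap D).
Proof.
  intros HD [u v] Huv. destruct (HD (v, u) Huv) as [e He].
  exists e. intros [a b] [Ha Hb]. apply He. now split.
Qed.

Lemma Ck_swap n D F : open D -> Ck n D F -> Ck n (swap D) (fun u v => F v u).
Proof.
  intros HD HF. apply (Ck_comp n (swap D) D F (fun _ v => v) (fun u _ => u));
    auto using open_swap, Ck_fst, Ck_snd.
Qed.

(** * Local coordinates and the inverse function theorem *)

Definition local_coords (D : R * R -> Prop) (p : R * R) (phi1 phi2 : R -> R -> R) : Prop :=
  exists V W : R * R -> Prop,
    V p /\ (forall q, V q -> D q) /\ diffeomorphism V W phi1 phi2.

Lemma open_preimage (D E : R * R -> Prop) (F1 F2 : R -> R -> R) : open D -> open E ->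
  (forall x y, D (x, y) -> continuity_2d_pt F1 x y) ->
  (forall x y, D (x, y) -> continuity_2d_pt F2 x y) ->
  open (fun q : R * R => D q /\ E (F1 (fst q) (snd q), F2 (fst q) (snd q))).
Proof.
  intros HD HE H1 H2 [x y] [Hxy HExy]. simpl in HExy.
  assert (HL : locally_2d (fun u v => D (u, v) /\ E (F1 u v, F2 u v)) x y).
  { apply locally_2d_and; [now apply open_locally_2d|].
    destruct (open_locally_2d E _ _ HE HExy) as [d Hd].
    apply locally_2d_impl with (2 := locally_2d_and _ _ _ _ (H1 x y Hxy d) (H2 x y Hxy d)).
    apply locally_2d_forall. intros u v [? ?]. now apply Hd. }
  apply locally_2d_locally in HL.
  apply filter_imp with (2 := HL). now intros [u v].
Qed.

Lemma smooth2_continuous D F x y : smooth2_on D F -> D (x, y) -> continuity_2d_pt F x y.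
Proof. intros HF. apply Ck_continuous with 0%nat. now apply smooth2_Ck. Qed.

Lemma smooth2_subset (D D' : R * R -> Prop) F :
  (forall q, D' q -> D q) -> smooth2_on D F -> smooth2_on D' F.
Proof. intros H HF n x y Hxy. apply HF, H, Hxy. Qed.

Lemma smooth2_ext D F G : open D -> (forall x y, D (x, y) -> F x y = G x y) ->
  smooth2_on D F -> smooth2_on D G.
Proof.
  intros HD H HF. apply smooth2_Ck. intros n. apply Ck_ext with F; auto.
  now apply smooth2_Ck.
Qed.

Lemma smooth2_comp D E F G1 G2 : open D -> open E ->
  (forall x y, D (x, y) -> E (G1 x y, G2 x y)) ->
  smooth2_on E F -> smooth2_on D G1 -> smooth2_on D G2 ->
  smooth2_on D (fun u v => F (G1 u v) (G2 u v)).
Proof.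
  intros HD HE HG HF H1 H2. apply smooth2_Ck. intros n.
  apply Ck_comp with E; auto; now apply smooth2_Ck.
Qed.

Lemma smooth2_swap D F : open D -> smooth2_on D F -> smooth2_on (swap D) (fun u v => F v u).
Proof.
  intros HD HF. apply smooth2_Ck. intros n. apply Ck_swap; auto. now apply smooth2_Ck.
Qed.

Lemma smooth2_differentiable D F x y : open D -> smooth2_on D F -> D (x, y) ->
  differentiable_pt_lim F x y (dd_u F x y) (dd_v F x y).
Proof. intros HD HF. apply Ck_differentiable with 0%nat; auto. now apply smooth2_Ck. Qed.

Lemma local_coords_comp D E p phi1 phi2 chi1 chi2 :
  local_coords D p phi1 phi2 ->
  local_coords E (phi1 (fst p) (snd p), phi2 (fst p) (snd p)) chi1 chi2 ->
  local_coords D p (fun u v => chi1 (phi1 u v) (phi2 u v))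
                   (fun u v => chi2 (phi1 u v) (phi2 u v)).
Proof.
  intros (V & W & Vp & VD & oV & oW & psi1 & psi2 & sphi1 & sphi2 & spsi1 & spsi2
          & mphi & mpsi & Lphi & Lpsi).
  intros (V' & W' & Vp' & VD' & oV' & oW' & xi1 & xi2 & schi1 & schi2 & sxi1 & sxi2
          & mchi & mxi & Lchi & Lxi).
  (* Both ends shrink: the source to the points sent into the second chart, the target to the points
     whose preimage under the second map lies in the image of the first chart. *)
  exists (fun q => V q /\ V' (phi1 (fst q) (snd q), phi2 (fst q) (snd q))).
  exists (fun q => W' q /\ W (xi1 (fst q) (snd q), xi2 (fst q) (snd q))).
  assert (o1 : open (fun q => V q /\ V' (phi1 (fst q) (snd q), phi2 (fst q) (snd q)))).
  { apply open_preimage; auto; intros x y Hxy; apply smooth2_continuous with V; auto. }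
  assert (o2 : open (fun q => W' q /\ W (xi1 (fst q) (snd q), xi2 (fst q) (snd q)))).
  { apply open_preimage; auto; intros x y Hxy; apply smooth2_continuous with W'; auto. }
  split; [now split|split; [intros q [Hq _]; auto|]].
  split; [exact o1|split; [exact o2|]].
  exists (fun u v => psi1 (xi1 u v) (xi2 u v)), (fun u v => psi2 (xi1 u v) (xi2 u v)).
  repeat apply conj.
  - apply smooth2_comp with V'; auto; try (intros x y Hxy; apply Hxy);
      eapply smooth2_subset; try eassumption; intros q Hq; apply Hq.
  - apply smooth2_comp with V'; auto; try (intros x y Hxy; apply Hxy);
      eapply smooth2_subset; try eassumption; intros q Hq; apply Hq.
  - apply smooth2_comp with W; auto; try (intros x y Hxy; apply Hxy);
      eapply smooth2_subset; try eassumption; intros q Hq; apply Hq.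
  - apply smooth2_comp with W; auto; try (intros x y Hxy; apply Hxy);
      eapply smooth2_subset; try eassumption; intros q Hq; apply Hq.
  - intros u v [H1 H2]; simpl in *. split; [now apply mchi|].
    simpl. destruct (Lchi _ _ H2) as [-> ->]. now apply mphi.
  - intros u v [H1 H2]; simpl in *. split; [now apply mpsi|].
    simpl. destruct (Lpsi _ _ H2) as [-> ->]. now apply mxi.
  - intros u v [H1 H2]; simpl in *. destruct (Lchi _ _ H2) as [-> ->]. now apply Lphi.
  - intros u v [H1 H2]; simpl in *. destruct (Lpsi _ _ H2) as [-> ->]. now apply Lxi.
Qed.

Lemma local_coords_ext D p phi1 phi2 chi1 chi2 :
  (forall u v, D (u, v) -> phi1 u v = chi1 u v /\ phi2 u v = chi2 u v) ->
  local_coords D p phi1 phi2 -> local_coords D p chi1 chi2.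
Proof.
  intros H (V & W & Vp & VD & oV & oW & psi1 & psi2 & sphi1 & sphi2 & spsi1 & spsi2
          & mphi & mpsi & Lphi & Lpsi).
  assert (H' : forall u v, V (u, v) -> phi1 u v = chi1 u v /\ phi2 u v = chi2 u v) by auto.
  exists V, W. do 4 (split; auto). exists psi1, psi2. repeat apply conj; auto.
  - apply smooth2_ext with phi1; auto. intros; now apply H'.
  - apply smooth2_ext with phi2; auto. intros; now apply H'.
  - intros u v Huv. destruct (H' u v Huv) as [<- <-]. now apply mphi.
  - intros u v Huv. destruct (H' u v Huv) as [<- <-]. now apply Lphi.
  - intros u v Huv. destruct (H' _ _ (mpsi u v Huv)) as [<- <-]. now apply Lpsi.
Qed.

Lemma local_coords_subset (D D' : R * R -> Prop) p phi1 phi2 :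
  (forall q, D q -> D' q) -> local_coords D p phi1 phi2 -> local_coords D' p phi1 phi2.
Proof. intros H (V & W & Vp & VD & HVW). exists V, W. auto. Qed.

Lemma smooth2_fst D : open D -> smooth2_on D (fun u _ => u).
Proof. intros HD. apply smooth2_Ck. intros n. now apply Ck_fst. Qed.

Lemma smooth2_snd D : open D -> smooth2_on D (fun _ v => v).
Proof. intros HD. apply smooth2_Ck. intros n. now apply Ck_snd. Qed.

Lemma local_coords_id D p : open D -> D p -> local_coords D p (fun u _ => u) (fun _ v => v).
Proof.
  intros HD Dp. exists D, D. do 4 (split; auto).
  exists (fun u _ => u), (fun _ v => v). repeat apply conj; auto using smooth2_fst, smooth2_snd;
  try (intros u v Huv; exact Huv); intros u v _; split; reflexivity.
Qed.

Lemma local_coords_swap D p : open D -> D p -> local_coords D p (fun _ v => v) (fun u _ => u).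
Proof.
  intros HD Dp. exists D, (swap D). do 4 (split; auto using open_swap).
  exists (fun _ v => v), (fun u _ => u).
  repeat apply conj; auto using open_swap, smooth2_fst, smooth2_snd;
  try (intros u v Huv; exact Huv); intros u v _; split; reflexivity.
Qed.

(** * Inverse function theorem, by decomposition into shears *)

Lemma differentiable_implicit F psi u w lx ly : ly <> 0 ->
  differentiable_pt_lim F u (psi u w) lx ly -> continuity_2d_pt psi u w ->
  F u (psi u w) = w ->
  locally_2d (fun u' w' => F u' (psi u' w') = w') u w ->
  differentiable_pt_lim psi u w (- lx / ly) (/ ly).
Proof.
  intros Hly HF Hpsi H0 Himp eps.
  assert (Hl : 0 < Rabs ly) by now apply Rabs_pos_lt.
  assert (Hlx : 0 <= Rabs lx) by apply Rabs_pos.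
  (* [K] bounds the increment of [psi] by the increment of its arguments. The summand 1 makes [K] at
     least 1, so that it bounds [du] too. *)
  set (K := 2 * (1 + Rabs lx + Rabs ly) / Rabs ly + 1).
  assert (HK : 1 <= K).
  { unfold K. assert (0 <= 2 * (1 + Rabs lx + Rabs ly) / Rabs ly); [|lra].
    apply Rdiv_le_0_compat; lra. }
  (* The first bound lets the remainder [S], which involves [dv] itself, be absorbed into the
     left-hand side of [B1]; the second makes the final error at most [eps]. *)
  set (e1 := Rmin (Rabs ly / 2) (eps * Rabs ly / K)).
  assert (He1 : 0 < e1).
  { destruct eps as [e He]; simpl in *. apply Rmin_glb_lt; [lra|].
    apply Rdiv_lt_0_compat; [apply Rmult_lt_0_compat; lra|lra]. }
  assert (He1a : e1 <= Rabs ly / 2) by apply Rmin_l.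
  assert (He1b : e1 * K <= eps * Rabs ly).
  { apply Rle_trans with (eps * Rabs ly / K * K).
    - apply Rmult_le_compat_r; [lra|apply Rmin_r].
    - right. field. lra. }
  destruct (HF (mkposreal e1 He1)) as [d Hd]; simpl in Hd.
  assert (Hball : locally_2d (fun u' w' => Rabs (u' - u) < d) u w) by now exists d.
  destruct (locally_2d_and _ _ _ _ Hball (locally_2d_and _ _ _ _ (Hpsi d) Himp)) as [r Hr].
  exists r. intros u' w' Hu' Hw'. destruct (Hr u' w' Hu' Hw') as (Hu & Hv & Hi).
  specialize (Hd u' (psi u' w') Hu Hv). rewrite Hi, H0 in Hd.
  set (du := u' - u) in *. set (dw := w' - w) in *. set (dv := psi u' w' - psi u w) in *.
  set (S := dw - (lx * du + ly * dv)) in *.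
  assert (Edv : dv * ly = dw - lx * du - S) by (unfold S; ring).
  set (m := Rmax (Rabs du) (Rabs dw)).
  assert (Hmu : Rabs du <= m) by apply Rmax_l.
  assert (Hmw : Rabs dw <= m) by apply Rmax_r.
  assert (Hm0 : 0 <= m) by (apply Rle_trans with (2 := Hmu), Rabs_pos).
  assert (Hv0 := Rabs_pos dv). assert (Hu0 := Rabs_pos du).
  assert (Hmax : Rmax (Rabs du) (Rabs dv) <= Rabs du + Rabs dv) by (apply Rmax_lub; lra).
  assert (B1 : Rabs dv * Rabs ly <= Rabs dw + Rabs lx * Rabs du + Rabs S).
  { rewrite <- !Rabs_mult, Edv.
    replace (dw - lx * du - S) with (dw + - (lx * du) + - S) by ring.
    eapply Rle_trans; [apply Rabs_triang|]. rewrite Rabs_Ropp. apply Rplus_le_compat_r.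
    eapply Rle_trans; [apply Rabs_triang|]. rewrite Rabs_Ropp. lra. }
  assert (B2 : Rabs dv * Rabs ly <= 2 * (1 + Rabs lx + Rabs ly) * m) by nra.
  assert (B3 : Rmax (Rabs du) (Rabs dv) <= K * m).
  { apply Rmax_lub; [nra|]. apply Rmult_le_reg_r with (Rabs ly); [exact Hl|].
    apply Rle_trans with (1 := B2).
    apply Rle_trans with (2 * (1 + Rabs lx + Rabs ly) * m + m * Rabs ly); [nra|].
    right. unfold K. field. lra. }
  replace (dv - (- lx / ly * du + / ly * dw)) with (- S / ly)
    by (unfold S; field; exact Hly).
  unfold Rdiv. rewrite Rabs_mult, Rabs_Ropp, Rabs_inv.
  apply Rmult_le_reg_r with (Rabs ly); [exact Hl|].
  rewrite Rmult_assoc, Rinv_l, Rmult_1_r by lra.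
  apply Rle_trans with (1 := Hd).
  apply Rle_trans with (e1 * (K * m)); [apply Rmult_le_compat_l; lra|].
  fold m. nra.
Qed.

Definition box (u0 v0 a b : R) : R * R -> Prop :=
  fun q => Rabs (fst q - u0) < a /\ Rabs (snd q - v0) < b.

Lemma open_box u0 v0 a b : open (box u0 v0 a b).
Proof.
  intros [x y] [Hx Hy]; simpl in *.
  assert (Hd : 0 < Rmin (a - Rabs (x - u0)) (b - Rabs (y - v0))) by (apply Rmin_glb_lt; lra).
  exists (mkposreal _ Hd). intros [x' y'] [Hx' Hy']; simpl in *.
  change (Rabs (x' - x) < Rmin (a - Rabs (x - u0)) (b - Rabs (y - v0))) in Hx'.
  change (Rabs (y' - y) < Rmin (a - Rabs (x - u0)) (b - Rabs (y - v0))) in Hy'.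
  assert (H1 := Rmin_l (a - Rabs (x - u0)) (b - Rabs (y - v0))).
  assert (H2 := Rmin_r (a - Rabs (x - u0)) (b - Rabs (y - v0))).
  split; simpl.
  - replace (x' - u0) with ((x' - x) + (x - u0)) by ring.
    eapply Rle_lt_trans; [apply Rabs_triang|lra].
  - replace (y' - v0) with ((y' - y) + (y - v0)) by ring.
    eapply Rle_lt_trans; [apply Rabs_triang|lra].
Qed.

(** Only one component has to be inverted: on a small square [F u] is strictly increasing, so the
    inverse comes from the intermediate value theorem on each vertical line. *)
Lemma local_coords_shear_pos D F (u0 v0 : R) : open D -> smooth2_on D F -> D (u0, v0) ->
  0 < dd_v F u0 v0 -> local_coords D (u0, v0) (fun u _ => u) F.
Proof.
  intros HD HF Hp Hpos.
  assert (CFv : continuity_2d_pt (dd_v F) u0 v0).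
  { apply Ck_continuous with 0%nat D; auto. apply Ck_dd_v. now apply smooth2_Ck. }
  (* Taking the value of [dd_v F] at the centre as tolerance keeps [dd_v F] positive on the whole
     square. *)
  destruct (locally_2d_and _ _ _ _ (open_locally_2d D u0 v0 HD Hp)
              (CFv (mkposreal _ Hpos))) as [d Hd]; simpl in Hd.
  assert (Hd0 : 0 < d) by apply cond_pos.
  set (V := box u0 v0 d d).
  assert (VD : forall q, V q -> D q).
  { intros [u v] [Hu Hv]. now apply Hd. }
  assert (Fpos : forall u v, V (u, v) -> 0 < dd_v F u v).
  { intros u v [Hu Hv]. destruct (Hd u v Hu Hv) as [_ H].
    apply Rabs_def2 in H. simpl in H. lra. }
  assert (FC : forall u v, V (u, v) -> continuity_2d_pt F u v).
  { intros u v Huv. apply smooth2_continuous with D; auto. }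
  assert (Fv : forall u v, V (u, v) -> is_derive (fun z => F u z) v (dd_v F u v)).
  { intros u v Huv. apply Ck_is_derive_v with 0%nat D; auto. now apply smooth2_Ck. }
  assert (between : forall u v1 v2 v, V (u, v1) -> V (u, v2) -> v1 <= v <= v2 -> V (u, v)).
  { intros u v1 v2 v [H1 H2] [H3 H4] H; simpl in *. split; auto. simpl.
    apply Rabs_def2 in H2. apply Rabs_def2 in H4. apply Rabs_def1; lra. }
  assert (Fcont : forall u v, V (u, v) -> continuity_pt (fun z => F u z) v).
  { intros u v Huv. apply continuity_pt_filterlim.
    apply (ex_derive_continuous (fun z => F u z)). eexists. now apply Fv. }
  assert (mono : forall u v1 v2, V (u, v1) -> V (u, v2) -> v1 < v2 -> F u v1 < F u v2).
  { intros u v1 v2 H1 H2 Hlt.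
    destruct (MVT_gen (fun z => F u z) v1 v2 (fun z => dd_v F u z)) as [c [Hc E]].
    - rewrite Rmin_left, Rmax_right by lra. intros x Hx. apply Fv.
      apply between with v1 v2; auto; lra.
    - rewrite Rmin_left, Rmax_right by lra. intros x Hx. apply Fcont.
      apply between with v1 v2; auto; lra.
    - rewrite Rmin_left, Rmax_right in Hc by lra.
      assert (0 < dd_v F u c) by (apply Fpos, between with v1 v2; auto).
      nra. }
  assert (inj : forall u v1 v2, V (u, v1) -> V (u, v2) -> F u v1 = F u v2 -> v1 = v2).
  { intros u v1 v2 H1 H2 E. destruct (Rtotal_order v1 v2) as [H|[H|H]]; auto.
    - apply mono with (u := u) in H; auto; lra.
    - apply mono with (u := u) in H; auto; lra. }
  set (W := fun q : R * R => exists v, V (fst q, v) /\ F (fst q) v = snd q).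
  set (psi := fun u w => epsilon (inhabits 0) (fun v => V (u, v) /\ F u v = w)).
  assert (psiE : forall u w, W (u, w) -> V (u, psi u w) /\ F u (psi u w) = w).
  { intros u w H. apply (epsilon_spec (inhabits 0) (fun v => V (u, v) /\ F u v = w) H). }
  (* Openness of [W] and continuity of [psi] together: [F u (v - eta) < w < F u (v + eta)] persists
     for nearby [u'] and [w'], which puts a root within [eta] of [v]. *)
  assert (key : forall u w, W (u, w) -> forall eps : posreal,
    locally_2d (fun u' w' => W (u', w') /\ Rabs (psi u' w' - psi u w) < eps) u w).
  { intros u w HW eps. destruct (psiE u w HW) as [HV E]. set (v := psi u w) in *.
    assert (Hv : 0 < d - Rabs (v - v0)) by (destruct HV as [_ H]; simpl in H; lra).
    assert (Hu : 0 < d - Rabs (u - u0)) by (destruct HV as [H _]; simpl in H; lra).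
    set (eta := Rmin eps (d - Rabs (v - v0)) / 2).
    assert (He0 : 0 < eta) by (unfold eta; assert (0 < Rmin eps (d - Rabs (v - v0)))
      by (apply Rmin_glb_lt; [apply cond_pos|lra]); lra).
    assert (He1 : eta < eps) by (unfold eta in *;
      generalize (Rmin_l eps (d - Rabs (v - v0))); lra).
    assert (He2 : eta < d - Rabs (v - v0)) by (unfold eta in *;
      generalize (Rmin_r eps (d - Rabs (v - v0))); lra).
    assert (Hbox : forall u' v', Rabs (u' - u) < d - Rabs (u - u0) -> Rabs (v' - v) <= eta ->
              V (u', v')).
    { intros u' v' H1 H2. split; simpl.
      - replace (u' - u0) with ((u' - u) + (u - u0)) by ring.
        eapply Rle_lt_trans; [apply Rabs_triang|lra].
      - replace (v' - v0) with ((v' - v) + (v - v0)) by ring.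
        eapply Rle_lt_trans; [apply Rabs_triang|lra]. }
    assert (Huu : Rabs (u - u) < d - Rabs (u - u0)) by (rewrite Rminus_diag, Rabs_R0; lra).
    assert (Vm : V (u, v - eta)).
    { apply Hbox; auto. replace (v - eta - v) with (- eta) by ring.
      rewrite Rabs_Ropp, Rabs_pos_eq; lra. }
    assert (Vp : V (u, v + eta)).
    { apply Hbox; auto. replace (v + eta - v) with eta by ring.
      rewrite Rabs_pos_eq; lra. }
    assert (Lm : 0 < (w - F u (v - eta)) / 2).
    { assert (F u (v - eta) < F u v) by (apply mono; auto; lra). lra. }
    assert (Lp : 0 < (F u (v + eta) - w) / 2).
    { assert (F u v < F u (v + eta)) by (apply mono; auto; lra). lra. }
    destruct (FC _ _ Vm (mkposreal _ Lm)) as [dm Hdm].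
    destruct (FC _ _ Vp (mkposreal _ Lp)) as [dp Hdp].
    simpl in Hdm, Hdp.
    set (g := Rmin (Rmin dm dp) (Rmin (d - Rabs (u - u0))
              (Rmin ((w - F u (v - eta)) / 2) ((F u (v + eta) - w) / 2)))).
    assert (Hg : 0 < g).
    { unfold g. repeat apply Rmin_glb_lt; auto; apply cond_pos. }
    exists (mkposreal g Hg). simpl. intros u' w' Hu' Hw'.
    assert (g <= dm) by (unfold g; eapply Rle_trans; [apply Rmin_l|apply Rmin_l]).
    assert (g <= dp) by (unfold g; eapply Rle_trans; [apply Rmin_l|apply Rmin_r]).
    assert (g <= d - Rabs (u - u0))
      by (unfold g; eapply Rle_trans; [apply Rmin_r|apply Rmin_l]).
    assert (g <= (w - F u (v - eta)) / 2)
      by (unfold g; eapply Rle_trans; [apply Rmin_r|]; eapply Rle_trans; [apply Rmin_r|apply Rmin_l]).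
    assert (g <= (F u (v + eta) - w) / 2)
      by (unfold g; eapply Rle_trans; [apply Rmin_r|]; eapply Rle_trans; [apply Rmin_r|apply Rmin_r]).
    assert (Hm : F u' (v - eta) < w').
    { assert (Q : Rabs (F u' (v - eta) - F u (v - eta)) < (w - F u (v - eta)) / 2).
      { apply Hdm; [lra|]. rewrite Rminus_diag, Rabs_R0. apply cond_pos. }
      apply Rabs_def2 in Q. apply Rabs_def2 in Hw'. lra. }
    assert (Hp' : w' < F u' (v + eta)).
    { assert (Q : Rabs (F u' (v + eta) - F u (v + eta)) < (F u (v + eta) - w) / 2).
      { apply Hdp; [lra|]. rewrite Rminus_diag, Rabs_R0. apply cond_pos. }
      apply Rabs_def2 in Q. apply Rabs_def2 in Hw'. lra. }
    assert (Hseg : forall z, v - eta <= z <= v + eta -> V (u', z)).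
    { intros z Hz. apply Hbox; [lra|]. apply Rabs_le. lra. }
    destruct (IVT_interv (fun z => F u' z - w') (v - eta) (v + eta)) as [z [Hz Ez]].
    - intros a Ha. apply continuity_pt_minus; [apply Fcont, Hseg, Ha|].
      apply continuity_pt_const. intros ? ?; reflexivity.
    - lra.
    - lra.
    - lra.
    - assert (HW' : W (u', w')) by (exists z; simpl; split; [apply Hseg, Hz|lra]).
      split; [exact HW'|]. destruct (psiE u' w' HW') as [H6 H7].
      replace (psi u' w') with z by (apply (inj u'); auto; lra).
      apply Rle_lt_trans with eta; auto. apply Rabs_le. lra. }
  assert (oW : open W).
  { intros [u w] HW. 
    apply filter_imp with (2 := proj1 (locally_2d_locally _ _ _) (key u w HW (mkposreal 1 Rlt_0_1))).
    intros [u' w'] H. apply H. }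
  assert (psiC : forall u w, W (u, w) -> continuity_2d_pt psi u w).
  { intros u w HW eps. apply locally_2d_impl with (2 := key u w HW eps).
    apply locally_2d_forall. tauto. }
  assert (psiD : forall u w, W (u, w) -> differentiable_pt_lim psi u w
            (- dd_u F u (psi u w) / dd_v F u (psi u w)) (/ dd_v F u (psi u w))).
  { intros u w HW. destruct (psiE u w HW) as [HV E]. apply differentiable_implicit with F; auto.
    - apply Rgt_not_eq, Fpos, HV.
    - apply smooth2_differentiable with D; auto.
    - apply locally_2d_impl with (2 := open_locally_2d W u w oW HW).
      apply locally_2d_forall. intros u' w' HW'. now apply psiE. }
  assert (oV : open V) by apply open_box.
  assert (psiS : smooth2_on W psi).
  (* Bootstrap: the partials of [psi] are smooth expressions in [psi] itself, so order n gives order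
     n + 1. *)
  { apply smooth2_Ck. intros n. induction n as [|n IH].
    - intros u w HW. split; [now apply psiC|exact I].
    - assert (Cc : forall G, Ck n V G -> Ck n W (fun u w => G u (psi u w))).
      { intros G HG. apply (Ck_comp n W V G (fun u _ => u) psi); auto using Ck_fst.
        intros u w HW. apply psiE, HW. }
      assert (C1 : Ck n W (fun u w => dd_u F u (psi u w))).
      { apply (Cc (dd_u F)). apply Ck_dd_u, Ck_subset with D; auto. now apply smooth2_Ck. }
      assert (C2 : Ck n W (fun u w => dd_v F u (psi u w))).
      { apply (Cc (dd_v F)). apply Ck_dd_v, Ck_subset with D; auto. now apply smooth2_Ck. }
      assert (N2 : forall u w, W (u, w) -> dd_v F u (psi u w) <> 0).
      { intros u w HW. apply Rgt_not_eq, Fpos, psiE, HW. }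
      apply Ck_intro_differentiable with (3 := Ck_div n W _ _ oW N2 (Ck_opp n W _ oW C1) C2)
        (4 := Ck_inv n W _ oW N2 C2); auto. }
  exists V, W. split; [split; simpl; rewrite Rminus_diag, Rabs_R0; exact Hd0|].
  split; [exact VD|split; [exact oV|split; [exact oW|]]].
  exists (fun u _ => u), psi. repeat apply conj.
  - apply smooth2_fst; auto.
  - apply smooth2_subset with D; auto.
  - apply smooth2_fst; auto.
  - exact psiS.
  - intros u v Huv. exists v. auto.
  - intros u w HW. apply psiE, HW.
  - intros u v Huv. split; auto.
    assert (HW : W (u, F u v)) by (exists v; auto).
    destruct (psiE _ _ HW). now apply (inj u).
  - intros u w HW. split; auto. apply psiE, HW.
Qed.

Lemma local_coords_shear D F (u0 v0 : R) : open D -> smooth2_on D F -> D (u0, v0) ->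
  dd_v F u0 v0 <> 0 -> local_coords D (u0, v0) (fun u _ => u) F.
Proof.
  intros HD HF Hp Hne. destruct (Rtotal_order (dd_v F u0 v0) 0) as [H|[H|H]]; [|easy|].
  2: now apply local_coords_shear_pos.
  assert (oT : open (fun _ : R * R => True)) by apply open_true.
  assert (Sneg : forall D' G, open D' -> smooth2_on D' G -> smooth2_on D' (fun u v => - G u v)).
  { intros D' G HD' HG. apply smooth2_Ck. intros n. apply Ck_opp; auto. now apply smooth2_Ck. }
  apply local_coords_ext with (fun u _ => u) (fun u v => - - F u v).
  { intros u v _. split; [reflexivity|ring]. }
  (* A decreasing [F] is handled by shearing with [- F] and then reflecting the second
     coordinate. *)
  apply (local_coords_comp D (fun _ => True) (u0, v0) (fun u _ => u) (fun u v => - F u v)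
           (fun u _ => u) (fun _ w => - w)).
  - apply local_coords_shear_pos; auto. unfold dd_v. rewrite Derive_opp.
    change (Derive (F u0) v0 < 0) in H. apply Ropp_0_gt_lt_contravar, H.
  - exists (fun _ => True), (fun _ => True).
    split; [exact I|split; [intros; exact I|split; [exact oT|split; [exact oT|]]]].
    exists (fun u _ => u), (fun _ w => - w).
    repeat apply conj; try (intros u v _; exact I); auto using smooth2_fst, smooth2_snd;
      intros u v _; split; solve [reflexivity|ring].
Qed.

Definition jacobian (phi1 phi2 : R -> R -> R) (u v : R) : R :=
  dd_u phi1 u v * dd_v phi2 u v - dd_v phi1 u v * dd_u phi2 u v.

Lemma differentiable_dd F u v lx ly : differentiable_pt_lim F u v lx ly ->
  dd_u F u v = lx /\ dd_v F u v = ly.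
Proof. apply differentiable_pt_lim_unique. Qed.

Lemma differentiable_fst u v : differentiable_pt_lim (fun x _ => x) u v 1 0.
Proof. apply differentiable_pt_lim_proj1_0, derivable_pt_lim_id. Qed.

Lemma differentiable_snd u v : differentiable_pt_lim (fun _ y => y) u v 0 1.
Proof.
  intros eps. exists (mkposreal 1 Rlt_0_1). intros x y _ _.
  replace (y - v - (0 * (x - u) + 1 * (y - v))) with 0 by ring. rewrite Rabs_R0.
  apply Rmult_le_pos; [left; apply cond_pos|].
  eapply Rle_trans; [apply Rabs_pos|apply Rmax_l].
Qed.

(** The map factors as the shear to [(u, phi2)], a swap, the shear by [chi] to [(phi2, phi1)], and a
    swap back, where [chi] is [phi1] expressed through [u] and [phi2]. *)
Lemma local_coords_of_jacobian_v D phi1 phi2 (u0 v0 : R) : open D ->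
  smooth2_on D phi1 -> smooth2_on D phi2 -> D (u0, v0) ->
  jacobian phi1 phi2 u0 v0 <> 0 -> dd_v phi2 u0 v0 <> 0 ->
  local_coords D (u0, v0) phi1 phi2.
Proof.
  intros HD S1 S2 Hp HJ Hv.
  destruct (local_coords_shear D phi2 u0 v0 HD S2 Hp Hv) as (V & W & Vp & VD & HVW).
  assert (oV := proj1 HVW). assert (oW := proj1 (proj2 HVW)).
  destruct HVW as (_ & _ & psi1 & psi2 & HVW).
  assert (L1 : local_coords V (u0, v0) (fun u _ => u) phi2).
  { exists V, W. split; [exact Vp|split; [auto|split; [exact oV|split; [exact oW|]]]].
    now exists psi1, psi2. }
  destruct HVW as (_ & _ & sp1 & sp2 & mphi & mpsi & Lphi & Lpsi).
  set (w0 := phi2 u0 v0).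
  set (chi := fun u w => phi1 (psi1 u w) (psi2 u w)).
  assert (HW0 : W (u0, w0)) by (apply (mphi u0 v0 Vp)).
  assert (schi : smooth2_on W chi) by (apply (smooth2_comp W V phi1); auto; now apply smooth2_subset with D).
  assert (Echi : forall u v, V (u, v) -> chi u (phi2 u v) = phi1 u v).
  { intros u v Huv. unfold chi. now destruct (Lphi u v Huv) as [-> ->]. }
  (* If this derivative vanished, the gradient of [phi1] would be a multiple of that of [phi2] and
     the Jacobian would be zero. *)
  assert (Hchi : dd_u chi u0 w0 <> 0).
  { assert (D1 := smooth2_differentiable W chi u0 w0 oW schi HW0).
    assert (D2 := smooth2_differentiable D phi2 u0 v0 HD S2 Hp).
    assert (D3 := differentiable_pt_lim_comp chi (fun u _ => u) phi2 u0 v0 _ _ _ _ _ _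
                    D1 (differentiable_fst u0 v0) D2).
    apply differentiable_pt_lim_ext with (f2 := phi1) in D3.
    - apply differentiable_dd in D3. unfold jacobian in HJ. destruct D3 as [D3u D3v].
      intros E. apply HJ. rewrite D3u, D3v, E. ring.
    - apply locally_2d_impl with (2 := open_locally_2d V u0 v0 oV Vp).
      apply locally_2d_forall. exact Echi. }
  apply local_coords_subset with V; auto.
  apply local_coords_ext with (fun u v => chi u (phi2 u v)) phi2.
  { intros u v Huv. split; auto. }
  assert (oT : open (fun _ : R * R => True)) by apply open_true.
  assert (L2 : local_coords W (u0, w0) (fun _ w => w) (fun u _ => u)).
  { now apply local_coords_swap. }
  assert (L3 : local_coords (swap W) (w0, u0) (fun w _ => w) (fun w u => chi u w)).
  { apply local_coords_shear; auto using open_swap, smooth2_swap. }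
  assert (L4 : local_coords (fun _ => True) (w0, chi u0 w0) (fun _ w => w) (fun u _ => u)).
  { now apply local_coords_swap. }
  assert (L12 := local_coords_comp _ _ _ _ _ _ _ L1 L2). cbn beta in L12.
  assert (L123 := local_coords_comp _ _ _ _ _ _ _ L12 L3). cbn beta in L123.
  exact (local_coords_comp _ _ _ _ _ _ _ L123 L4).
Qed.

Lemma local_coords_of_jacobian D phi1 phi2 (u0 v0 : R) : open D ->
  smooth2_on D phi1 -> smooth2_on D phi2 -> D (u0, v0) ->
  jacobian phi1 phi2 u0 v0 <> 0 -> local_coords D (u0, v0) phi1 phi2.
Proof.
  intros HD S1 S2 Hp HJ. destruct (Req_dec (dd_v phi2 u0 v0) 0) as [E|Hv].
  2: now apply local_coords_of_jacobian_v.
  (* With [dd_v phi2 = 0] a nonzero Jacobian forces [dd_u phi2 <> 0], so the previous case applies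
     after exchanging the variables. *)
  assert (L : local_coords (swap D) (v0, u0) (fun v u => phi1 u v) (fun v u => phi2 u v)).
  { apply local_coords_of_jacobian_v; auto using open_swap, smooth2_swap.
    - intros E'. apply HJ. unfold jacobian. rewrite <- (Ropp_involutive 0), Ropp_0.
      rewrite <- E'. unfold jacobian, dd_u, dd_v. ring.
    - intros E'. apply HJ. unfold jacobian. rewrite E.
      change (dd_u phi2 u0 v0 = 0) in E'. rewrite E'. ring. }
  assert (L0 : local_coords D (u0, v0) (fun _ v => v) (fun u _ => u)).
  { now apply local_coords_swap. }
  exact (local_coords_comp _ _ _ _ _ _ _ L0 L).
Qed.

(** * Integrals depending on a parameter, and closed forms *)

Lemma continuity_2d_pt_fst_continuous F u v : continuity_2d_pt F u v -> continuous (fun z => F z v) u.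
Proof.
  intros H. apply (proj1 (continuity_pt_filterlim (fun z => F z v) u)).
  apply continuity_pt_locally. intros eps. destruct (H eps) as [d Hd]. exists d.
  intros y Hy. apply Hd; [exact Hy|]. rewrite Rminus_diag, Rabs_R0. apply cond_pos.
Qed.

Lemma continuity_2d_pt_snd_continuous F u v : continuity_2d_pt F u v -> continuous (fun z => F u z) v.
Proof.
  intros H. apply (proj1 (continuity_pt_filterlim (fun z => F u z) v)).
  apply continuity_pt_locally. intros eps. destruct (H eps) as [d Hd]. exists d.
  intros y Hy. apply Hd; [|exact Hy]. rewrite Rminus_diag, Rabs_R0. apply cond_pos.
Qed.

Lemma abs_RInt_le_dist (h : R -> R) a b M : ex_RInt h a b ->
  (forall s, Rmin a b <= s <= Rmax a b -> Rabs (h s) <= M) ->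
  Rabs (RInt h a b) <= M * Rabs (b - a).
Proof.
  intros Hex HM. destruct (Rle_lt_dec a b) as [H|H].
  - rewrite (Rabs_pos_eq (b - a)), Rmult_comm by lra. apply abs_RInt_le_const; auto.
    intros s Hs. apply HM. rewrite Rmin_left, Rmax_right; lra.
  - rewrite (Rabs_left (b - a)) by lra. rewrite <- opp_RInt_swap by (apply ex_RInt_swap, Hex).
    change (Rabs (- RInt h b a) <= M * - (b - a)). rewrite Rabs_Ropp.
    replace (M * - (b - a)) with ((a - b) * M) by ring.
    apply abs_RInt_le_const; [lra|apply ex_RInt_swap, Hex|].
    intros s Hs. apply HM. rewrite Rmin_right, Rmax_left; lra.
Qed.

Lemma between_dist (u0 u s a : R) : Rabs (u - u0) < a -> Rmin u0 u <= s <= Rmax u0 u ->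
  Rabs (s - u0) < a.
Proof.
  intros H Hs. apply Rle_lt_trans with (2 := H).
  unfold Rmin, Rmax in Hs. destruct (Rle_dec u0 u).
  - rewrite !Rabs_pos_eq; lra.
  - rewrite !Rabs_left1; lra.
Qed.

Lemma is_derive_RInt_interval (h : R -> R) (u0 a u : R) :
  (forall s, Rabs (s - u0) < a -> continuous h s) -> Rabs (u - u0) < a ->
  is_derive (fun x => RInt h u0 x) u (h u).
Proof.
  intros Hh Hu. apply is_derive_RInt with u0; [|now apply Hh].
  assert (Hd : 0 < a - Rabs (u - u0)) by lra.
  exists (mkposreal _ Hd). intros x Hx. change (Rabs (x - u) < a - Rabs (u - u0)) in Hx.
  apply @RInt_correct, @ex_RInt_continuous. intros z Hz. apply Hh.
  apply between_dist with x; auto.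
  replace (x - u0) with ((x - u) + (u - u0)) by ring.
  eapply Rle_lt_trans; [apply Rabs_triang|lra].
Qed.

Definition param_RInt (u0 : R) (gamma : R -> R -> R) (u c : R) : R :=
  RInt (fun s => gamma s c) u0 u.

Section Primitive.
Variables u0 v0 a b : R.
Notation B := (box u0 v0 a b).

Lemma ex_RInt_box gamma u c : Ck 0 B gamma -> B (u, c) -> ex_RInt (fun s => gamma s c) u0 u.
Proof.
  intros Hg [Hu Hc]. apply @ex_RInt_continuous. intros z Hz.
  apply continuity_2d_pt_fst_continuous. apply Hg. split; auto. simpl.
  now apply between_dist with u.
Qed.

Lemma param_RInt_is_derive_u gamma u c : Ck 0 B gamma -> B (u, c) ->
  is_derive (fun z => param_RInt u0 gamma z c) u (gamma u c).
Proof.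
  intros Hg [Hu Hc]. apply (is_derive_RInt_interval (fun s => gamma s c) u0 a); auto.
  intros s Hs. apply continuity_2d_pt_fst_continuous. apply Hg. now split.
Qed.

Lemma box_snd_locally c : Rabs (c - v0) < b -> locally c (fun c' => Rabs (c' - v0) < b).
Proof.
  intros Hc. assert (Hd : 0 < b - Rabs (c - v0)) by lra.
  exists (mkposreal _ Hd). intros x Hx. change (Rabs (x - c) < b - Rabs (c - v0)) in Hx.
  replace (x - v0) with ((x - c) + (c - v0)) by ring.
  eapply Rle_lt_trans; [apply Rabs_triang|lra].
Qed.

Lemma param_RInt_is_derive_v gamma u c : Ck 1 B gamma -> B (u, c) ->
  is_derive (fun z => param_RInt u0 gamma u z) c (param_RInt u0 (dd_v gamma) u c).
Proof.
  intros Hg [Hu Hc]; simpl in Hu, Hc.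
  apply (is_derive_RInt_param (fun c s => gamma s c) u0 u c).
  - apply filter_imp with (2 := box_snd_locally c Hc). intros c' Hc' s Hs.
    eexists. apply (Ck_is_derive_v 0 B); auto. split; auto. now apply between_dist with u.
  - intros s Hs. apply (Ck_continuous 0 (swap B) (fun c s => dd_v gamma s c)).
    + apply Ck_swap; [apply open_box|]. now apply Ck_dd_v.
    + split; auto. now apply between_dist with u.
  - apply filter_imp with (2 := box_snd_locally c Hc). intros c' Hc'.
    apply (ex_RInt_box gamma u c'); [|now split]. apply Ck_le with 1%nat; auto.
Qed.

Lemma param_RInt_continuous gamma : Ck 0 B gamma -> Ck 0 B (param_RInt u0 gamma).
Proof.
  intros Hg u c Huc. split; [|exact I]. intros eps.
  assert (Huc' := Huc). destruct Huc' as [Hu Hc]; simpl in Hu, Hc.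
  assert (Ha : 0 < a) by (apply Rle_lt_trans with (2 := Hu), Rabs_pos).
  (* Halfway to the edge: the segment of radius [r] is compact in the box and contains all upper
     limits near [u], so [gamma] is uniformly continuous in the parameter along it. *)
  set (r := (Rabs (u - u0) + a) / 2).
  assert (He : 0 < eps / (4 * a)).
  { apply Rdiv_lt_0_compat; [apply cond_pos|lra]. }
  destruct (uniform_continuity_2d_1d gamma (u0 - r) (u0 + r) c) with (eps := mkposreal _ He)
    as [d Hd].
  { intros s Hs. apply Hg. split; auto. simpl. apply Rle_lt_trans with r; [|unfold r; lra].
    apply Rabs_le. lra. }
  simpl in Hd.
  assert (Hcont := ex_derive_continuous _ _ (ex_intro _ _ (param_RInt_is_derive_u gamma u c Hg Huc))).
  assert (He2 : 0 < eps / 2) by (assert (H := cond_pos eps); lra).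
  destruct (proj1 (continuity_pt_locally _ _)
              (proj2 (continuity_pt_filterlim (fun z => param_RInt u0 gamma z c) u) Hcont)
              (mkposreal _ He2)) as [d2 Hd2]; simpl in Hd2.
  set (g := Rmin (Rmin d d2) (Rmin (b - Rabs (c - v0)) (r - Rabs (u - u0)))).
  assert (Hg0 : 0 < g).
  { unfold g. repeat apply Rmin_glb_lt; try apply cond_pos; unfold r; lra. }
  assert (G1 : g <= d) by (unfold g; eapply Rle_trans; [apply Rmin_l|apply Rmin_l]).
  assert (G2 : g <= d2) by (unfold g; eapply Rle_trans; [apply Rmin_l|apply Rmin_r]).
  assert (G3 : g <= b - Rabs (c - v0)) by (unfold g; eapply Rle_trans; [apply Rmin_r|apply Rmin_l]).
  assert (G4 : g <= r - Rabs (u - u0)) by (unfold g; eapply Rle_trans; [apply Rmin_r|apply Rmin_r]).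
  exists (mkposreal g Hg0); simpl. intros u' c' Hu' Hc'.
  assert (Hu'0 : Rabs (u' - u0) < r).
  { replace (u' - u0) with ((u' - u) + (u - u0)) by ring.
    eapply Rle_lt_trans; [apply Rabs_triang|lra]. }
  assert (Hra : r < a) by (unfold r; lra).
  assert (Hc'0 : Rabs (c' - v0) < b).
  { replace (c' - v0) with ((c' - c) + (c - v0)) by ring.
    eapply Rle_lt_trans; [apply Rabs_triang|lra]. }
  replace (param_RInt u0 gamma u' c' - param_RInt u0 gamma u c) with
    ((param_RInt u0 gamma u' c' - param_RInt u0 gamma u' c)
     + (param_RInt u0 gamma u' c - param_RInt u0 gamma u c)) by ring.
  eapply Rle_lt_trans; [apply Rabs_triang|].
  assert (Q2 : Rabs (param_RInt u0 gamma u' c - param_RInt u0 gamma u c) < eps / 2).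
  { apply Hd2. change (Rabs (u' - u) < d2). lra. }
  assert (Q1 : Rabs (param_RInt u0 gamma u' c' - param_RInt u0 gamma u' c) <= eps / (4 * a) * a).
  { unfold param_RInt.
    assert (E1 : ex_RInt (fun s => gamma s c') u0 u') by (apply ex_RInt_box; auto; split; simpl; lra).
    assert (E2 : ex_RInt (fun s => gamma s c) u0 u') by (apply ex_RInt_box; auto; split; simpl; lra).
    assert (EM := RInt_minus _ _ _ _ E1 E2). unfold minus, plus, opp in EM; simpl in EM.
    unfold Rminus at 1. rewrite <- EM.
    apply Rle_trans with (eps / (4 * a) * Rabs (u' - u0)).
    - apply abs_RInt_le_dist.
      + apply (@ex_RInt_minus R_NormedModule); auto.
      + intros s Hs. left.
        assert (Hs' : Rabs (s - u0) < r) by now apply between_dist with u'.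
        apply Rabs_def2 in Hs'. apply Rabs_def2 in Hc'.
        apply (Hd s c s c'); try lra. rewrite Rminus_diag, Rabs_R0. apply cond_pos.
    - apply Rmult_le_compat_l; lra. }
  replace (eps / (4 * a) * a) with (eps / 4) in Q1 by (field; lra).
  assert (H := cond_pos eps). lra.
Qed.

(** The derivative in the upper limit is [gamma]; the one in the parameter is again such an
    integral, of [dd_v gamma], at one order less. *)
Lemma Ck_param_RInt n gamma : Ck n B gamma -> Ck n B (param_RInt u0 gamma).
Proof.
  revert gamma. induction n as [|n IH]; intros gamma Hg; [now apply param_RInt_continuous|].
  apply Ck_intro with gamma (param_RInt u0 (dd_v gamma)); [apply open_box|..].
  - intros x y Hxy. apply param_RInt_is_derive_u; auto. apply Ck_le with (S n); auto with arith.
  - intros x y Hxy. apply param_RInt_is_derive_v; auto. apply Ck_le with (S n); auto with arith.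
  - apply Ck_le with (S n); auto with arith.
  - apply IH. now apply Ck_dd_v.
Qed.

Lemma poincare P Q : smooth2_on B P -> smooth2_on B Q -> B (u0, v0) ->
  (forall u v, B (u, v) -> dd_v P u v = dd_u Q u v) ->
  exists F, smooth2_on B F /\
    forall u v, B (u, v) -> differentiable_pt_lim F u v (P u v) (Q u v).
Proof.
  intros SP SQ Hp HPQ.
  assert (CP : forall n, Ck n B P) by now apply smooth2_Ck.
  assert (CQ : forall n, Ck n B Q) by now apply smooth2_Ck.
  (* Integration along an L-shaped path: up the line [u = u0], then horizontally. Closedness turns
     the integral of [dd_v P] into [Q u v - Q u0 v], which cancels the vertical part. *)
  set (F := fun u v => param_RInt u0 P u v + RInt (fun s => Q u0 s) v0 v).
  assert (Fu : forall u v, B (u, v) -> is_derive (fun z => F z v) u (P u v)).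
  { intros u v Huv. unfold F. rewrite <- (Rplus_0_r (P u v)).
    apply @is_derive_plus; [now apply param_RInt_is_derive_u|apply @is_derive_const]. }
  assert (Fv : forall u v, B (u, v) -> is_derive (fun z => F u z) v (Q u v)).
  { intros u v Huv. unfold F.
    assert (EQ : param_RInt u0 (dd_v P) u v = Q u v - Q u0 v).
    { unfold param_RInt. rewrite (RInt_ext _ (fun s => Derive (fun z => Q z v) s)).
      - destruct Huv as [Hu Hv]; simpl in Hu, Hv. apply (RInt_Derive (fun z => Q z v) u0 u).
        + intros s Hs. eexists. apply (Ck_is_derive_u 0 B Q s v); auto. split; auto.
          now apply between_dist with u.
        + intros s Hs. apply (continuity_2d_pt_fst_continuous (dd_u Q)).
          apply (Ck_continuous 0 B); [now apply Ck_dd_u|]. split; auto.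
          now apply between_dist with u.
      - intros s Hs. apply (HPQ s v). destruct Huv as [Hu Hv]. split; auto.
        apply between_dist with u; auto. split; apply Rlt_le, Hs. }
    replace (Q u v) with (plus (param_RInt u0 (dd_v P) u v) (Q u0 v))
      by (rewrite EQ; unfold plus; simpl; ring).
    apply @is_derive_plus; [now apply param_RInt_is_derive_v|].
    apply (is_derive_RInt_interval (fun s => Q u0 s) v0 b); [|apply Huv].
    intros s Hs. apply continuity_2d_pt_snd_continuous. apply (CQ 0%nat).
    split; auto. apply Hp. }
  exists F. split.
  - apply smooth2_Ck. intros [|n]; [apply Ck_le with 1%nat; auto|];
      apply Ck_intro with P Q; auto using open_box.
  - intros u v Huv. apply differentiable_of_partials with B; auto using open_box.
Qed.

End Primitive.

(** * Scalar differential equations and their dependence on the initial value *)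

Fixpoint picard (u0 : R) (beta : R -> R -> R) (n : nat) : R -> R -> R :=
  match n with
  | O => fun _ c => c
  | S n => fun u c => c + param_RInt u0 (fun s c => beta s (picard u0 beta n s c)) u c
  end.

Definition picard_lim (u0 : R) (beta : R -> R -> R) (u c : R) : R :=
  real (Lim_seq (fun n => picard u0 beta n u c)).

Section Picard.
Variables (u0 v0 d b L M : R) (beta : R -> R -> R).
Hypothesis beta_cont : forall u v, continuity_2d_pt beta u v.
Hypothesis beta_bound : forall u v, Rabs (beta u v) <= M.
Hypothesis beta_lip : forall u v1 v2, Rabs (beta u v1 - beta u v2) <= L * Rabs (v1 - v2).
Hypothesis d_pos : 0 < d.
Hypothesis L_nonneg : 0 <= L.
Hypothesis Ld_small : L * d <= 1 / 2.
Notation B := (box u0 v0 d b).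
Notation pic := (picard u0 beta).
Notation V := (picard_lim u0 beta).

Lemma Ck0_beta_comp F : Ck 0 B F -> Ck 0 B (fun s c => beta s (F s c)).
Proof.
  intros HF x y Hxy. split; [|exact I].
  apply (continuity_2d_pt_comp beta (fun s _ => s) F); auto.
  - apply continuity_2d_pt_id1.
  - now apply HF.
Qed.

Lemma Ck0_picard n : Ck 0 B (pic n).
Proof.
  induction n as [|n IH]; simpl.
  - apply Ck_snd, open_box.
  - apply Ck_plus; [apply open_box|apply Ck_snd, open_box|].
    apply Ck_param_RInt. now apply Ck0_beta_comp.
Qed.

Lemma param_RInt_diff_bound G1 G2 u c1 c2 K : Ck 0 B G1 -> Ck 0 B G2 -> 0 <= K ->
  B (u, c1) -> B (u, c2) ->
  (forall s, Rabs (s - u0) < d -> Rabs (G1 s c1 - G2 s c2) <= K) ->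
  Rabs (param_RInt u0 G1 u c1 - param_RInt u0 G2 u c2) <= K * d.
Proof.
  intros H1 H2 HK B1 B2 Hs. unfold param_RInt.
  assert (E1 := ex_RInt_box u0 v0 d b G1 u c1 H1 B1).
  assert (E2 := ex_RInt_box u0 v0 d b G2 u c2 H2 B2).
  assert (EM := RInt_minus _ _ _ _ E1 E2). unfold minus, plus, opp in EM; simpl in EM.
  unfold Rminus at 1. rewrite <- EM.
  destruct B1 as [Hu _]; simpl in Hu.
  apply Rle_trans with (K * Rabs (u - u0)).
  - apply abs_RInt_le_dist.
    + apply (@ex_RInt_minus R_NormedModule); auto.
    + intros s Hs'. apply Hs. now apply between_dist with u.
  - apply Rmult_le_compat_l; lra.
Qed.

Lemma M_nonneg : 0 <= M.
Proof. apply Rle_trans with (2 := beta_bound 0 0), Rabs_pos. Qed.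

(** The contraction estimate, with factor [L * d], at most 1/2. Allowing different [c1] and [c2]
    makes it serve for Lipschitz dependence on the initial value as well as for convergence. *)
Lemma param_RInt_beta_diff F1 F2 u c1 c2 K : Ck 0 B F1 -> Ck 0 B F2 -> 0 <= K ->
  B (u, c1) -> B (u, c2) ->
  (forall s, Rabs (s - u0) < d -> Rabs (F1 s c1 - F2 s c2) <= K) ->
  Rabs (param_RInt u0 (fun s c => beta s (F1 s c)) u c1
        - param_RInt u0 (fun s c => beta s (F2 s c)) u c2) <= K / 2.
Proof.
  intros H1 H2 HK B1 B2 Hs.
  apply Rle_trans with (L * K * d); [|nra].
  apply param_RInt_diff_bound; auto using Ck0_beta_comp.
  - now apply Rmult_le_pos.
  - intros s Hs'. apply Rle_trans with (1 := beta_lip _ _ _).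
    apply Rmult_le_compat_l; auto.
Qed.

Lemma param_RInt_beta_bound F u c : Ck 0 B F -> B (u, c) ->
  Rabs (param_RInt u0 (fun s c => beta s (F s c)) u c) <= M * d.
Proof.
  intros HF HB. assert (HM := M_nonneg).
  apply Rle_trans with (M * Rabs (u - u0)).
  - apply abs_RInt_le_dist; auto. apply (ex_RInt_box u0 v0 d b (fun s c => beta s (F s c)) u c); auto.
    now apply Ck0_beta_comp.
  - apply Rmult_le_compat_l; auto. destruct HB as [Hu _]; simpl in Hu; lra.
Qed.

Lemma picard_step n u c : B (u, c) -> Rabs (pic (S n) u c - pic n u c) <= M * d * (1 / 2) ^ n.
Proof.
  revert u. induction n as [|n IH]; intros u HB.
  - simpl. replace (c + _ - c) with (param_RInt u0 (fun s c => beta s c) u c) by ring.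
    rewrite Rmult_1_r. apply (param_RInt_beta_bound (fun _ c => c)); auto.
    apply Ck_snd, open_box.
  - change (pic (S (S n)) u c) with (c + param_RInt u0 (fun s c => beta s (pic (S n) s c)) u c).
    change (pic (S n) u c) with (c + param_RInt u0 (fun s c => beta s (pic n s c)) u c).
    assert (HM := M_nonneg).
    replace (M * d * (1 / 2) ^ S n) with (M * d * (1 / 2) ^ n / 2) by (simpl; field).
    match goal with |- Rabs (c + ?x - (c + ?y)) <= _ => replace (c + x - (c + y)) with (x - y) by ring end.
    apply param_RInt_beta_diff; auto using Ck0_picard.
    + apply Rmult_le_pos; [nra|]. apply pow_le; lra.
    + intros s Hs. apply IH. split; [exact Hs|apply HB].
Qed.

(** A telescoped geometric series. The subtracted tail is kept because with it each induction step
    is exact. *)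
Lemma picard_cauchy n k u c : B (u, c) ->
  Rabs (pic (n + k) u c - pic n u c) <= 2 * M * d * ((1 / 2) ^ n - (1 / 2) ^ (n + k)).
Proof.
  intros HB. induction k as [|k IH].
  - rewrite Nat.add_0_r, !Rminus_diag, Rabs_R0. lra.
  - rewrite Nat.add_succ_r.
    replace (pic (S (n + k)) u c - pic n u c) with
      ((pic (S (n + k)) u c - pic (n + k) u c) + (pic (n + k) u c - pic n u c)) by ring.
    eapply Rle_trans; [apply Rabs_triang|]. assert (H := picard_step (n + k) u c HB).
    replace ((1 / 2) ^ S (n + k)) with ((1 / 2) ^ (n + k) / 2) by (simpl; field). lra.
Qed.

Lemma geom_small (K : R) (eps : posreal) : 0 <= K ->
  exists n : nat, K * (1 / 2) ^ n < eps.
Proof.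
  intros HK. assert (He := cond_pos eps).
  destruct (pow_lt_1_zero (1 / 2)) with (y := eps / (K + 1)) as [N HN].
  - rewrite Rabs_pos_eq; lra.
  - apply Rdiv_lt_0_compat; lra.
  - exists N. specialize (HN N (le_n N)). rewrite Rabs_pos_eq in HN by (apply pow_le; lra).
    assert (0 < (1 / 2) ^ N) by (apply pow_lt; lra).
    apply Rmult_lt_compat_l with (r := K + 1) in HN; [|lra].
    replace ((K + 1) * (eps / (K + 1))) with (pos eps) in HN by (field; lra). nra.
Qed.

Lemma picard_is_lim u c : B (u, c) -> is_lim_seq (fun n => pic n u c) (V u c).
Proof.
  intros HB. apply Lim_seq_correct', ex_lim_seq_cauchy_corr.
  intros eps. assert (HM := M_nonneg).
  assert (HK : 0 <= 4 * M * d) by nra.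
  destruct (geom_small _ eps HK) as [N HN]. exists N.
  assert (A : forall n, (N <= n)%nat -> Rabs (pic n u c - pic N u c) <= 2 * M * d * (1 / 2) ^ N).
  { intros n Hn. replace n with (N + (n - N))%nat by lia.
    eapply Rle_trans; [now apply picard_cauchy|].
    assert (0 < (1 / 2) ^ (N + (n - N))) by (apply pow_lt; lra). nra. }
  intros n m Hn Hm. replace (pic n u c - pic m u c) with
    ((pic n u c - pic N u c) + - (pic m u c - pic N u c)) by ring.
  eapply Rle_lt_trans; [apply Rabs_triang|]. rewrite Rabs_Ropp.
  assert (A1 := A n Hn). assert (A2 := A m Hm). lra.
Qed.

Lemma lim_dist_le (w : nat -> R) (l x K : R) : is_lim_seq w l ->
  (forall n, Rabs (w n - x) <= K) -> Rabs (l - x) <= K.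
Proof.
  intros Hw H. 
  assert (H1 : is_lim_seq (fun n => Rabs (w n - x)) (Rabs (l - x))).
  { apply (is_lim_seq_abs (fun n => w n - x) (Finite (l - x))).
    apply is_lim_seq_minus'; [exact Hw|apply is_lim_seq_const]. }
  exact (is_lim_seq_le _ _ _ _ H H1 (is_lim_seq_const K)).
Qed.

Lemma picard_lim_dist n u c : B (u, c) -> Rabs (V u c - pic n u c) <= 2 * M * d * (1 / 2) ^ n.
Proof.
  intros HB. apply lim_dist_le with (fun k => pic (k + n) u c).
  - apply (is_lim_seq_incr_n (fun k => pic k u c)). now apply picard_is_lim.
  - intros k. rewrite Nat.add_comm. eapply Rle_trans; [now apply picard_cauchy|].
    assert (0 < (1 / 2) ^ (n + k)) by (apply pow_lt; lra).
    assert (HM := M_nonneg). assert (0 <= 2 * M * d) by nra. nra.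
Qed.

Lemma Ck0_picard_lim : Ck 0 B V.
Proof.
  intros u c HB. split; [|exact I]. intros eps. assert (HM := M_nonneg).
  assert (He := cond_pos eps).
  assert (H3 : 0 < eps / 3) by lra.
  (* A uniform limit of continuous functions: an [eps / 3] argument. *)
  destruct (geom_small (2 * M * d) (mkposreal _ H3)) as [n Hn]; [nra|]. simpl in Hn.
  destruct (Ck0_picard n u c HB) as [Hc _].
  apply locally_2d_impl with (2 := locally_2d_and _ _ _ _
     (open_locally_2d B u c (open_box _ _ _ _) HB) (Hc (mkposreal _ H3))).
  apply locally_2d_forall. intros u' c' [HB' Hd]. simpl in Hd.
  replace (V u' c' - V u c) with
    ((V u' c' - pic n u' c') + (pic n u' c' - pic n u c) + - (V u c - pic n u c)) by ring.
  eapply Rle_lt_trans; [apply Rabs_triang|]. rewrite Rabs_Ropp.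
  assert (T := Rabs_triang (V u' c' - pic n u' c') (pic n u' c' - pic n u c)).
  assert (A1 := picard_lim_dist n u' c' HB'). assert (A2 := picard_lim_dist n u c HB). lra.
Qed.

Lemma picard_lim_eq u c : B (u, c) ->
  V u c = c + param_RInt u0 (fun s c => beta s (V s c)) u c.
Proof.
  intros HB. assert (HM := M_nonneg).
  apply Rminus_diag_uniq. apply NNPP. intros Hne. apply Rabs_pos_lt in Hne.
  destruct (geom_small (2 * M * d) (mkposreal _ Hne)) as [n Hn]; [nra|]. simpl in Hn.
  apply Rlt_not_le with (1 := Hn); clear Hn.
  (* The two sides differ from iterate [S n] by at most [M * d * (1 / 2) ^ n] each: the left by the
     rate of convergence, the right because the integral operator halves distances. *)
  assert (A1 := picard_lim_dist (S n) u c HB).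
  change (pic (S n) u c) with (c + param_RInt u0 (fun s c => beta s (pic n s c)) u c) in A1.
  assert (A2 : Rabs (param_RInt u0 (fun s c => beta s (V s c)) u c
     - param_RInt u0 (fun s c => beta s (pic n s c)) u c) <= 2 * M * d * (1 / 2) ^ n / 2).
  { apply param_RInt_beta_diff; auto using Ck0_picard, Ck0_picard_lim.
    - apply Rmult_le_pos; [nra|]. apply pow_le; lra.
    - intros s Hs. apply picard_lim_dist. split; [exact Hs|apply HB]. }
  replace ((1 / 2) ^ S n) with ((1 / 2) ^ n / 2) in A1 by (simpl; field).
  match type of A2 with Rabs (?x - ?y) <= _ => set (p := x) in *; set (q := y) in * end.
  replace (V u c - (c + p)) with ((V u c - (c + q)) + - (p - q)) by ring.
  eapply Rle_trans; [apply Rabs_triang|]. rewrite Rabs_Ropp. lra.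
Qed.

(** The constant 2 is the fixed point of K = 1 + K / 2, so every iterate satisfies the same
    bound. *)
Lemma picard_lim_lipschitz u c1 c2 : B (u, c1) -> B (u, c2) ->
  Rabs (V u c1 - V u c2) <= 2 * Rabs (c1 - c2).
Proof.
  intros HB1 HB2.
  assert (HP : forall n u, B (u, c1) -> B (u, c2) ->
    Rabs (pic n u c1 - pic n u c2) <= 2 * Rabs (c1 - c2)).
  { clear u HB1 HB2. assert (H0 := Rabs_pos (c1 - c2)).
    induction n as [|n IH]; intros u HB1 HB2; simpl; [lra|].
    assert (A : Rabs (param_RInt u0 (fun s c => beta s (pic n s c)) u c1
        - param_RInt u0 (fun s c => beta s (pic n s c)) u c2) <= 2 * Rabs (c1 - c2) / 2).
    { apply param_RInt_beta_diff; auto using Ck0_picard; [lra|].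
      intros s Hs. apply IH; split; auto; [apply HB1|apply HB2]. }
    match type of A with Rabs (?x - ?y) <= _ => set (p := x) in *; set (q := y) in * end.
    replace (c1 + p - (c2 + q)) with ((c1 - c2) + (p - q)) by ring.
    eapply Rle_trans; [apply Rabs_triang|]. lra. }
  rewrite <- (Rminus_0_r (V u c1 - V u c2)).
  apply lim_dist_le with (fun n => pic n u c1 - pic n u c2).
  - apply is_lim_seq_minus'; now apply picard_is_lim.
  - intros n. rewrite Rminus_0_r. now apply HP.
Qed.

End Picard.

(** Precomposing with the nearest-point map onto an interval extends a function from a square to the
    plane while keeping its bound and Lipschitz constant; the Picard iteration above assumes both
    globally. *)
Definition clamp (x0 r x : R) : R := Rmax (x0 - r) (Rmin (x0 + r) x).

Lemma clamp_dist x0 r x : 0 <= r -> Rabs (clamp x0 r x - x0) <= r.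
Proof.
  intros Hr. apply Rabs_le. unfold clamp, Rmax, Rmin.
  destruct (Rle_dec (x0 + r) x); destruct (Rle_dec (x0 - r)); lra.
Qed.

Lemma clamp_id x0 r x : Rabs (x - x0) <= r -> clamp x0 r x = x.
Proof.
  intros Hx. apply Rabs_le_between in Hx. unfold clamp.
  rewrite Rmin_right, Rmax_right; lra.
Qed.

Lemma clamp_lip x0 r x y : 0 <= r -> Rabs (clamp x0 r x - clamp x0 r y) <= Rabs (x - y).
Proof.
  intros Hr. unfold clamp, Rmax, Rmin.
  destruct (Rle_dec (x0 + r) x); destruct (Rle_dec (x0 + r) y);
  repeat match goal with |- context [Rle_dec ?a ?b] => destruct (Rle_dec a b) end;
  unfold Rabs; repeat match goal with |- context [Rcase_abs ?a] => destruct (Rcase_abs a) end; lra.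
Qed.

Lemma continuity_2d_pt_clamp beta u0 v0 r u v : 0 <= r ->
  (forall u v, Rabs (u - u0) <= r -> Rabs (v - v0) <= r -> continuity_2d_pt beta u v) ->
  continuity_2d_pt (fun u v => beta (clamp u0 r u) (clamp v0 r v)) u v.
Proof.
  intros Hr Hc.
  apply (continuity_2d_pt_comp beta (fun u _ => clamp u0 r u) (fun _ v => clamp v0 r v)).
  - apply Hc; now apply clamp_dist.
  - intros eps. exists eps. intros x y Hx _. eapply Rle_lt_trans; [now apply clamp_lip|exact Hx].
  - intros eps. exists eps. intros x y _ Hy. eapply Rle_lt_trans; [now apply clamp_lip|exact Hy].
Qed.

Lemma mean_value_v (D : R * R -> Prop) F u v1 v2 : Ck 1 D F ->
  (forall v, Rmin v1 v2 <= v <= Rmax v1 v2 -> D (u, v)) ->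
  exists v, Rmin v1 v2 <= v <= Rmax v1 v2 /\ F u v2 - F u v1 = dd_v F u v * (v2 - v1).
Proof.
  intros HF H. apply (MVT_gen (F u) v1 v2 (fun v => dd_v F u v)).
  - intros v Hv. apply (Ck_is_derive_v 0 D F u v); auto. apply H. lra.
  - intros v Hv. apply continuity_pt_filterlim.
    apply (ex_derive_continuous (F u)). eexists. apply (Ck_is_derive_v 0 D F u v); auto.
Qed.

Lemma between_ball (v0 r v1 v2 v : R) : Rabs (v1 - v0) <= r -> Rabs (v2 - v0) <= r ->
  Rmin v1 v2 <= v <= Rmax v1 v2 -> Rabs (v - v0) <= r.
Proof.
  intros H1 H2 Hv. apply Rabs_le_between in H1. apply Rabs_le_between in H2.
  apply Rabs_le. unfold Rmin, Rmax in Hv. destruct (Rle_dec v1 v2); lra.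
Qed.

Lemma between_dist2 (v1 v2 v : R) : Rmin v1 v2 <= v <= Rmax v1 v2 ->
  Rabs (v - v1) <= Rabs (v2 - v1).
Proof.
  intros Hv. unfold Rmin, Rmax in Hv. destruct (Rle_dec v1 v2).
  - rewrite !Rabs_pos_eq; lra.
  - rewrite !Rabs_left1; lra.
Qed.

(** * Differentiability of the solution in its initial value *)

Section Flow.
Variables (D : R * R -> Prop) (beta V : R -> R -> R) (u0 v0 d b r L : R).
Notation B := (box u0 v0 d b).
Hypothesis D_open : open D.
Hypothesis beta_smooth : smooth2_on D beta.
Hypothesis rect_D : forall u v, Rabs (u - u0) <= r -> Rabs (v - v0) <= r -> D (u, v).
Hypothesis d_pos : 0 < d.
Hypothesis d_le_1 : d <= 1.
Hypothesis d_le_r : d <= r.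
Hypothesis Ld_small : L * d <= 1.
Hypothesis beta_v_bound : forall u v, Rabs (u - u0) <= r -> Rabs (v - v0) <= r ->
  Rabs (dd_v beta u v) <= L.
Hypothesis V_cont : Ck 0 B V.
Hypothesis V_range : forall u c, B (u, c) -> Rabs (V u c - v0) <= r.
Hypothesis V_init : forall c, Rabs (c - v0) < b -> V u0 c = c.
Hypothesis V_lip : forall u c1 c2, B (u, c1) -> B (u, c2) ->
  Rabs (V u c1 - V u c2) <= 2 * Rabs (c1 - c2).
Hypothesis V_ode : forall u c, B (u, c) -> is_derive (fun z => V z c) u (beta u (V u c)).

(** The coefficient of the variational equation along the solution starting at [c]. *)
Let beta_v_along := fun s c => dd_v beta s (V s c).

Lemma flow_D u c : B (u, c) -> D (u, V u c).
Proof.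
  intros HB. apply rect_D; [|now apply V_range].
  destruct HB as [Hu _]; simpl in Hu; lra.
Qed.

Lemma Ck_along n F : Ck n D F -> Ck n B V -> Ck n B (fun s c => F s (V s c)).
Proof.
  intros HF HV. apply (Ck_comp n B D F (fun s _ => s) V); auto using open_box, Ck_fst.
  exact flow_D.
Qed.

Lemma Ck_beta n : Ck n D beta.
Proof. now apply smooth2_Ck. Qed.

Lemma Ck0_beta_v_along : Ck 0 B beta_v_along.
Proof. apply Ck_along; auto. apply Ck_dd_v, Ck_beta. Qed.

Lemma beta_v_along_bound u c : B (u, c) -> Rabs (param_RInt u0 beta_v_along u c) <= 1.
Proof.
  intros HB. apply Rle_trans with (L * Rabs (u - u0)).
  - apply abs_RInt_le_dist.
    + apply (ex_RInt_box u0 v0 d b beta_v_along); auto using Ck0_beta_v_along.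
    + intros s Hs. assert (Hs' : Rabs (s - u0) < d).
      { apply between_dist with u; auto. apply HB. }
      apply beta_v_bound; [lra|]. apply V_range. split; [exact Hs'|apply HB].
  - destruct HB as [Hu Hc]; simpl in Hu.
    assert (0 <= L).
    { eapply Rle_trans; [apply Rabs_pos|apply (beta_v_bound u0 v0)];
        rewrite Rminus_diag, Rabs_R0; lra. }
    assert (H1 := Rabs_pos (u - u0)). nra.
Qed.

Lemma exp_bound x : Rabs x <= 1 -> exp x <= 3.
Proof.
  intros Hx. apply Rabs_le_between in Hx. apply Rle_trans with (2 := exp_le_3).
  destruct (Rle_lt_or_eq_dec x 1); [lra| |subst; lra]. left. now apply exp_increasing.
Qed.

(* Multiplying the difference of two solutions by the integrating factor of the
   linearised equation leaves a remainder that is controlled by the modulus of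
   continuity of [dd_v beta]. *)
Lemma flow_linearisation u c (e : posreal) : B (u, c) ->
  locally c (fun c' => Rabs (V u c' - V u c - (c' - c) * exp (param_RInt u0 beta_v_along u c))
                       <= e * Rabs (c' - c)).
Proof.
  intros HB. assert (HB' := HB). destruct HB' as [Hu Hc]; simpl in Hu, Hc.
  (* 18 = 2 * 3 * 3: the Lipschitz constant of [V] in [c], and the bound 3 on the exponential of
     [- I] and on that of [I]. *)
  assert (He18 : 0 < e / 18) by (assert (H := cond_pos e); lra).
  set (k := Rabs (u - u0)) in *.
  assert (Hk0 : 0 <= k) by apply Rabs_pos.
  assert (Hseg : forall s, Rabs (s - u0) <= k -> B (s, c)).
  { intros s Hs. split; simpl; auto; lra. }
  (* Uniformity in [s] over the whole time segment is what is needed; [w] stands for the deviation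
     from the solution starting at [c]. *)
  destruct (uniform_continuity_2d_1d (fun s w => dd_v beta s (V s c + w)) (u0 - k) (u0 + k) 0)
    with (eps := mkposreal _ He18) as [d1 Hd1].
  { intros s Hs. assert (Hs' : Rabs (s - u0) <= k) by (apply Rabs_le; lra).
    apply (continuity_2d_pt_comp (dd_v beta) (fun s _ => s) (fun s w => V s c + w)).
    - rewrite Rplus_0_r. apply (Ck_continuous 0 D); [apply Ck_dd_v, Ck_beta|].
      now apply flow_D, Hseg.
    - apply continuity_2d_pt_id1.
    - apply (continuity_2d_pt_plus (fun s _ => V s c) (fun _ w => w)).
      + apply (continuity_2d_pt_comp V (fun s _ => s) (fun _ _ => c)).
        * apply (Ck_continuous 0 B); auto.
        * apply continuity_2d_pt_id1.
        * apply continuity_2d_pt_const.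
      + apply continuity_2d_pt_id2. }
  simpl in Hd1.
  (* Half of [d1], since solutions separate by at most twice [Rabs (c' - c)]. *)
  assert (Hd2 : 0 < d1 / 2) by (assert (H := cond_pos d1); lra).
  apply filter_imp with (fun c' => Rabs (c' - v0) < b /\ Rabs (c' - c) < d1 / 2).
  2: { apply filter_and; [now apply box_snd_locally|]. exists (mkposreal _ Hd2).
       intros y Hy; exact Hy. }
  intros c' [Hc' Hcc].
  assert (Hseg' : forall s, Rabs (s - u0) <= k -> B (s, c')).
  { intros s Hs. split; simpl; auto; lra. }
  set (I := fun s => param_RInt u0 beta_v_along s c).
  set (Z := fun s => (V s c' - V s c) * exp (- I s)).
  assert (HZ : Rabs (Z u - Z u0) <= (e / 3 * Rabs (c' - c)) * Rabs (u - u0)).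
  { apply (bounded_variation Z (fun s =>
      (beta s (V s c') - beta s (V s c)) * exp (- I s)
      + (V s c' - V s c) * (- beta_v_along s c * exp (- I s)))).
    intros s Hs. fold k in Hs. split.
    - apply (Derive.is_derive_mult (fun s => V s c' - V s c) (fun s => exp (- I s))).
      + apply @is_derive_minus; apply V_ode; auto.
      + apply (is_derive_comp exp (fun s => - I s)); [apply is_derive_exp|].
        apply @is_derive_opp. apply (param_RInt_is_derive_u u0 v0 d b); auto using Ck0_beta_v_along.
    - destruct (mean_value_v D beta s (V s c) (V s c')) as (xi & Hxi & Exi).
      { apply Ck_beta. }
      { intros v Hv. apply rect_D; [lra|].
        apply between_ball with (3 := Hv); apply V_range; auto. }
      rewrite Exi.
      replace (dd_v beta s xi * (V s c' - V s c) * exp (- I s)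
        + (V s c' - V s c) * (- beta_v_along s c * exp (- I s)))
        with ((dd_v beta s xi - beta_v_along s c) * (V s c' - V s c) * exp (- I s)) by ring.
      rewrite !Rabs_mult, (Rabs_pos_eq (exp _)) by (left; apply exp_pos).
      assert (A1 := V_lip s c' c (Hseg' s Hs) (Hseg s Hs)).
      assert (A2 : exp (- I s) <= 3).
      { apply exp_bound. rewrite Rabs_Ropp. apply beta_v_along_bound; auto. }
      assert (A3 : Rabs (dd_v beta s xi - beta_v_along s c) <= e / 18).
      { assert (Hxd := between_dist2 _ _ _ Hxi).
        assert (Hs' := proj1 (Rabs_le_between _ _) Hs).
        assert (Hxd' : Rabs (xi - V s c) <= d1) by lra.
        apply Rabs_le_between in Hxd'.
        left. unfold beta_v_along.
        replace (dd_v beta s xi) with (dd_v beta s (V s c + (xi - V s c)))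
          by (f_equal; ring).
        replace (dd_v beta s (V s c)) with (dd_v beta s (V s c + 0))
          by (f_equal; ring).
        assert (Hd1' := cond_pos d1).
        apply Hd1; try lra. rewrite Rminus_diag, Rabs_R0. lra. }
      replace (e / 3 * Rabs (c' - c)) with (e / 18 * (2 * Rabs (c' - c)) * 3) by field.
      apply Rmult_le_compat; auto.
      + apply Rmult_le_pos; apply Rabs_pos.
      + left; apply exp_pos.
      + apply Rmult_le_compat; auto; apply Rabs_pos. }
  assert (EZ0 : Z u0 = c' - c).
  { unfold Z, I, param_RInt. rewrite RInt_point. change (zero : R) with 0.
    rewrite Ropp_0, exp_0, !V_init by assumption. ring. }
  replace (V u c' - V u c - (c' - c) * exp (param_RInt u0 beta_v_along u c))
    with ((Z u - Z u0) * exp (I u)).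
  2: { rewrite EZ0. unfold Z. fold (I u). rewrite exp_Ropp. field. apply Rgt_not_eq, exp_pos. }
  rewrite Rabs_mult, (Rabs_pos_eq (exp _)) by (left; apply exp_pos).
  assert (A2 : exp (I u) <= 3).
  { apply exp_bound, beta_v_along_bound; auto. }
  assert (H0 := cond_pos e). assert (H1 := Rabs_pos (c' - c)). fold k in HZ.
  assert (HZ' : Rabs (Z u - Z u0) <= e / 3 * Rabs (c' - c)).
  { apply Rle_trans with (1 := HZ). rewrite <- (Rmult_1_r (e / 3 * Rabs (c' - c))) at 2.
    apply Rmult_le_compat_l; [apply Rmult_le_pos; lra|lra]. }
  replace (e * Rabs (c' - c)) with (e / 3 * Rabs (c' - c) * 3) by field.
  apply Rmult_le_compat; auto; [apply Rabs_pos|left; apply exp_pos].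
Qed.

Lemma flow_is_derive_v u c : B (u, c) ->
  is_derive (fun z => V u z) c (exp (param_RInt u0 beta_v_along u c)).
Proof.
  intros HB. split; [apply @is_linear_scal_l|].
  intros x Hx. rewrite <- (is_filter_lim_locally_unique (c : R_NormedModule) x Hx). intros e.
  apply filter_imp with (2 := flow_linearisation u c e HB).
  intros c' H. exact H.
Qed.

Lemma flow_smooth : smooth2_on B V.
Proof.
  apply smooth2_Ck. intros n. induction n as [|n IH]; [exact V_cont|].
  apply Ck_intro with (fun u c => beta u (V u c)) (fun u c => exp (param_RInt u0 beta_v_along u c)).
  - apply open_box.
  - exact V_ode.
  - exact flow_is_derive_v.
  - apply Ck_along; auto using Ck_beta.
  - apply Ck_exp; [apply open_box|]. apply Ck_param_RInt. apply Ck_along; auto.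
    apply Ck_dd_v, Ck_beta.
Qed.

End Flow.

Lemma flow_exists D beta (u0 v0 : R) : open D -> smooth2_on D beta -> D (u0, v0) ->
  exists d b V, 0 < d /\ 0 < b /\ smooth2_on (box u0 v0 d b) V /\
    (forall c, Rabs (c - v0) < b -> V u0 c = c) /\
    forall u c, box u0 v0 d b (u, c) ->
      D (u, V u c) /\ is_derive (fun z => V z c) u (beta u (V u c)) /\ 0 < dd_v V u c.
Proof.
  intros HD Hb Hp.
  assert (Cb : forall n, Ck n D beta) by now apply smooth2_Ck.
  destruct (locally_2d_and _ _ _ _ (open_locally_2d D u0 v0 HD Hp)
    (locally_2d_and _ _ _ _ (Ck_continuous 0 D beta u0 v0 (Cb 0%nat) Hp (mkposreal 1 Rlt_0_1))
      (Ck_continuous 0 D (dd_v beta) u0 v0 (Ck_dd_v _ _ _ (Cb 1%nat)) Hp (mkposreal 1 Rlt_0_1))))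
    as [r0 Hr0]; simpl in Hr0.
  (* Halving passes from the open square of half-width [r0] to a closed one inside it, as clamping
     requires. The summands 1 in [M] and [L] are the continuity tolerances used above. *)
  set (r := r0 / 2). assert (Hr : 0 < r) by (unfold r; assert (H := cond_pos r0); lra).
  set (M := Rabs (beta u0 v0) + 1). set (L := Rabs (dd_v beta u0 v0) + 1).
  assert (HM : 1 <= M) by (unfold M; assert (H := Rabs_pos (beta u0 v0)); lra).
  assert (HL : 1 <= L) by (unfold L; assert (H := Rabs_pos (dd_v beta u0 v0)); lra).
  assert (Hrect : forall u v, Rabs (u - u0) <= r -> Rabs (v - v0) <= r ->
    D (u, v) /\ Rabs (beta u v) <= M /\ Rabs (dd_v beta u v) <= L).
  { intros u v H1 H2. destruct (Hr0 u v) as (H3 & H4 & H5); [unfold r in *; lra..|].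
    split; [exact H3|]. split.
    - replace (beta u v) with ((beta u v - beta u0 v0) + beta u0 v0) by ring.
      eapply Rle_trans; [apply Rabs_triang|]. unfold M; lra.
    - replace (dd_v beta u v) with ((dd_v beta u v - dd_v beta u0 v0) + dd_v beta u0 v0) by ring.
      eapply Rle_trans; [apply Rabs_triang|]. unfold L; lra. }
  set (bt := fun u v => beta (clamp u0 r u) (clamp v0 r v)).
  (* In order: 1 keeps the time factor in the linearisation estimate harmless, [r] stays in the
     square, [/ (2 * L)] gives the contraction, and [r / (2 * M)] limits the drift to [r / 2], so
     that with [b = r / 2] solutions never leave the square. *)
  set (d := Rmin 1 (Rmin r (Rmin (/ (2 * L)) (r / (2 * M))))).
  assert (Hd : 0 < d).
  { unfold d. repeat apply Rmin_glb_lt; [lra|exact Hr|apply Rinv_0_lt_compat; lra|].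
    apply Rdiv_lt_0_compat; lra. }
  assert (D1 : d <= 1) by apply Rmin_l.
  assert (D2 : d <= r) by (unfold d; eapply Rle_trans; [apply Rmin_r|apply Rmin_l]).
  assert (D3 : d <= / (2 * L)).
  { unfold d; eapply Rle_trans; [apply Rmin_r|]; eapply Rle_trans; [apply Rmin_r|apply Rmin_l]. }
  assert (D4 : d <= r / (2 * M)).
  { unfold d; eapply Rle_trans; [apply Rmin_r|]; eapply Rle_trans; [apply Rmin_r|apply Rmin_r]. }
  assert (LD : L * d <= 1 / 2).
  { apply Rle_trans with (L * / (2 * L)); [apply Rmult_le_compat_l; lra|right; field; lra]. }
  assert (MD : M * d <= r / 2).
  { apply Rle_trans with (M * (r / (2 * M))); [apply Rmult_le_compat_l; lra|right; field; lra]. }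
  assert (Hr' : 0 <= r) by lra.
  assert (bt_cont : forall u v, continuity_2d_pt bt u v).
  { intros u v. apply continuity_2d_pt_clamp; auto. intros x y Hx Hy.
    apply (Ck_continuous 0 D); auto. now apply Hrect. }
  assert (bt_bound : forall u v, Rabs (bt u v) <= M).
  { intros u v. apply Hrect; now apply clamp_dist. }
  assert (bt_lip : forall u v1 v2, Rabs (bt u v1 - bt u v2) <= L * Rabs (v1 - v2)).
  { intros u v1 v2. unfold bt.
    assert (Hball : forall v, Rmin (clamp v0 r v2) (clamp v0 r v1) <= v
        <= Rmax (clamp v0 r v2) (clamp v0 r v1) -> Rabs (v - v0) <= r).
    { intros v Hv. apply between_ball with (3 := Hv); now apply clamp_dist. }
    destruct (mean_value_v D beta (clamp u0 r u) (clamp v0 r v2) (clamp v0 r v1))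
      as (xi & Hxi & ->); auto.
    { intros v Hv. apply Hrect; [now apply clamp_dist|auto]. }
    rewrite Rabs_mult. apply Rmult_le_compat; try apply Rabs_pos; [|now apply clamp_lip].
    apply Hrect; [now apply clamp_dist|auto]. }
  set (b := r / 2). assert (Hb0 : 0 < b) by (unfold b; lra).
  set (V := picard_lim u0 bt).
  assert (HL0 : 0 <= L) by lra.
  assert (V_cont : Ck 0 (box u0 v0 d b) V) by now apply Ck0_picard_lim with L M.
  assert (V_eq : forall u c, box u0 v0 d b (u, c) ->
            V u c = c + param_RInt u0 (fun s c => bt s (V s c)) u c).
  { intros u c HB. now apply picard_lim_eq with v0 d b L M. }
  assert (V_range : forall u c, box u0 v0 d b (u, c) -> Rabs (V u c - v0) <= r).
  { intros u c HB. rewrite V_eq by exact HB.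
    assert (A := param_RInt_beta_bound u0 v0 d b M bt bt_cont bt_bound V u c V_cont HB).
    match type of A with Rabs ?x <= _ =>
      replace (c + x - v0) with ((c - v0) + x) by ring end.
    eapply Rle_trans; [apply Rabs_triang|].
    destruct HB as [_ Hc]; simpl in Hc. unfold b in Hc. lra. }
  assert (V_init : forall c, Rabs (c - v0) < b -> V u0 c = c).
  { intros c Hc. assert (HB : box u0 v0 d b (u0, c)).
    { split; auto. simpl. rewrite Rminus_diag, Rabs_R0. exact Hd. }
    rewrite V_eq by exact HB. unfold param_RInt. rewrite RInt_point.
    apply Rplus_0_r. }
  assert (V_ode : forall u c, box u0 v0 d b (u, c) ->
            is_derive (fun z => V z c) u (beta u (V u c))).
  { intros u c HB.
    apply (is_derive_ext_loc (fun z => c + param_RInt u0 (fun s c => bt s (V s c)) z c)).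
    - destruct (locally_2d_1d_const_y _ _ _ (open_locally_2d _ u c (open_box _ _ _ _) HB)) as [e He].
      exists e. intros z Hz. symmetry. apply V_eq. now apply He.
    - rewrite <- (Rplus_0_l (beta u (V u c))). apply @is_derive_plus; [apply @is_derive_const|].
      replace (beta u (V u c)) with (bt u (V u c)).
      + apply (param_RInt_is_derive_u u0 v0 d b (fun s c => bt s (V s c))); auto.
        apply Ck0_beta_comp; auto.
      (* Solutions stay in the square, so clamping is inactive along them and they solve the
         original equation. *)
      + unfold bt. rewrite !clamp_id; auto. destruct HB as [Hu _]; simpl in Hu; lra. }
  exists d, b, V. split; [exact Hd|]. split; [exact Hb0|].
  split; [|split; [exact V_init|]].
  - apply flow_smooth with D beta r L; auto; try (intros u v Hu Hv; now apply Hrect); try lra.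
    intros u c1 c2 H1 H2. now apply picard_lim_lipschitz with v0 d b L M.
  - intros u c HB. split; [|split; [now apply V_ode|]].
    + apply Hrect; [destruct HB as [Hu _]; simpl in Hu; lra|now apply V_range].
    + unfold dd_v. rewrite (is_derive_unique _ _ (exp (param_RInt u0 (fun s c => dd_v beta s (V s c)) u c)));
        [apply exp_pos|].
      apply flow_is_derive_v with D v0 d b r L; auto; try (intros x y Hx Hy; now apply Hrect); try lra.
      intros x c1 c2 H1 H2. now apply picard_lim_lipschitz with v0 d b L M.
Qed.

(** * Rectification of a plane vector field *)

Lemma open_nonzero D F : open D -> smooth2_on D F ->
  open (fun q : R * R => D q /\ F (fst q) (snd q) <> 0).
Proof.
  intros HD HF.
  apply (open_preimage D (fun q => fst q <> 0) F (fun _ _ => 0)); auto.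
  - intros [x y] Hx; simpl in Hx.
    assert (Hx' : 0 < Rabs x) by now apply Rabs_pos_lt.
    exists (mkposreal _ Hx'). intros [x' y'] [H _]; simpl in *.
    change (Rabs (x' - x) < Rabs x) in H. intros ->.
    rewrite Rminus_0_l, Rabs_Ropp in H. lra.
  - intros x y Hxy. now apply smooth2_continuous with D.
  - intros x y _. apply continuity_2d_pt_const.
Qed.

Lemma smooth2_div D F G : open D -> (forall u v, D (u, v) -> G u v <> 0) ->
  smooth2_on D F -> smooth2_on D G -> smooth2_on D (fun u v => F u v / G u v).
Proof.
  intros HD H0 HF HG. apply smooth2_Ck. intros n. apply Ck_div; auto; now apply smooth2_Ck.
Qed.

Lemma smooth2_const D c : open D -> smooth2_on D (fun _ _ => c).
Proof. intros HD. apply smooth2_Ck. intros n. now apply Ck_const. Qed.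

Lemma smooth2_mult D F G : open D -> smooth2_on D F -> smooth2_on D G ->
  smooth2_on D (fun u v => F u v * G u v).
Proof.
  intros HD HF HG. apply smooth2_Ck. intros n. apply Ck_mult; auto; now apply smooth2_Ck.
Qed.

Lemma smooth2_plus D F G : open D -> smooth2_on D F -> smooth2_on D G ->
  smooth2_on D (fun u v => F u v + G u v).
Proof.
  intros HD HF HG. apply smooth2_Ck. intros n. apply Ck_plus; auto; now apply smooth2_Ck.
Qed.

Lemma differentiable_local_unique D F G u v lx ly mx my : open D -> D (u, v) ->
  (forall x y, D (x, y) -> F x y = G x y) ->
  differentiable_pt_lim F u v lx ly -> differentiable_pt_lim G u v mx my ->
  lx = mx /\ ly = my.
Proof.
  intros HD Huv H HF HG.
  apply differentiable_pt_lim_ext with (f2 := G) in HF.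
  - apply differentiable_dd in HF. apply differentiable_dd in HG.
    destruct HF as [<- <-], HG as [<- <-]. now split.
  - apply locally_2d_impl with (2 := open_locally_2d D u v HD Huv).
    apply locally_2d_forall. exact H.
Qed.

(** Where [cu X] is nonzero, integral curves are graphs over [u]. The function [k] assigns to a
    point the height at which its curve crosses [u = u0], and [x] is the time elapsed since that
    crossing. *)
Lemma rectify_transverse D X (u0 v0 : R) : open D -> smooth_vfield D X -> D (u0, v0) ->
  cu X u0 v0 <> 0 ->
  exists (D' : R * R -> Prop) x k, open D' /\ D' (u0, v0) /\ (forall q, D' q -> D q) /\
    smooth2_on D' x /\ smooth2_on D' k /\
    forall u v, D' (u, v) ->
      lie_derivative X x u v = 1 /\ lie_derivative X k u v = 0 /\ dd_v k u v <> 0.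
Proof.
  intros HD [HXu HXv] Hp H0.
  set (D1 := fun q : R * R => D q /\ cu X (fst q) (snd q) <> 0).
  assert (oD1 : open D1) by now apply open_nonzero.
  assert (HXu1 : smooth2_on D1 (cu X)) by (apply smooth2_subset with D; auto; intros q Hq; apply Hq).
  assert (HXv1 : smooth2_on D1 (cv X)) by (apply smooth2_subset with D; auto; intros q Hq; apply Hq).
  assert (N1 : forall u v, D1 (u, v) -> cu X u v <> 0) by (intros u v Huv; apply Huv).
  set (beta := fun u v => cv X u v / cu X u v).
  assert (Sbeta : smooth2_on D1 beta) by now apply smooth2_div.
  destruct (flow_exists D1 beta u0 v0 oD1 Sbeta) as (d & b & V & Hd & Hb & SV & Vinit & HV).
  { now split. }
  set (B := box u0 v0 d b) in *. assert (oB : open B) by apply open_box.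
  assert (Bp : B (u0, v0)) by (split; simpl; rewrite Rminus_diag, Rabs_R0; auto).
  assert (V0 : V u0 v0 = v0) by (apply Vinit; rewrite Rminus_diag, Rabs_R0; auto).
  destruct (local_coords_shear B V u0 v0 oB SV Bp) as
    (N & W & Np & NB & oN & oW & psi1 & k & _ & _ & _ & Sk & mphi & mpsi & Lphi & Lpsi).
  { apply Rgt_not_eq, HV, Bp. }
  assert (HW : forall u v, W (u, v) -> B (u, k u v) /\ V u (k u v) = v).
  { intros u v Huv. destruct (Lpsi u v Huv) as [E1 E2]. rewrite E1 in E2.
    split; auto. apply NB. rewrite <- E1 at 1. now apply mpsi. }
  assert (WD1 : forall u v, W (u, v) -> D1 (u, v)).
  { intros u v Huv. destruct (HW u v Huv) as [H1 H2]. rewrite <- H2. now apply HV. }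
  assert (Hk : forall u v, W (u, v) -> lie_derivative X k u v = 0 /\ dd_v k u v <> 0).
  { intros u v Huv. destruct (HW u v Huv) as [H1 H2].
    destruct (HV _ _ H1) as (H3 & H4 & H5). rewrite H2 in H4.
    (* Differentiating [V u (k u v) = v] in both variables yields the partials of [k] up to the
       nonzero factor [dd_v V]. *)
    assert (E := differentiable_pt_lim_comp V (fun u _ => u) k u v _ _ _ _ _ _
      (smooth2_differentiable B V u (k u v) oB SV H1) (differentiable_fst u v)
      (smooth2_differentiable W k u v oW Sk Huv)).
    apply (differentiable_local_unique W _ (fun _ v => v) u v _ _ 0 1 oW Huv) in E;
      [|intros; now apply HW|apply differentiable_snd].
    destruct E as [E1 E2]. rewrite Rmult_0_r, Rplus_0_l in E2.
    replace (dd_u V u (k u v)) with (beta u v) in E1.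
    2: { symmetry. apply is_derive_unique, H4. }
    assert (Hv : dd_v k u v <> 0) by (intros E; rewrite E in E2; lra).
    split; [|exact Hv]. unfold lie_derivative.
    assert (Ha : cu X u v <> 0) by now apply N1, WD1.
    apply Rmult_eq_reg_l with (dd_v V u (k u v)); [|lra].
    replace (dd_v V u (k u v) * (cu X u v * dd_u k u v + cv X u v * dd_v k u v))
      with (cu X u v * (dd_v V u (k u v) * dd_u k u v)
            + cv X u v * (dd_v V u (k u v) * dd_v k u v)) by ring.
    rewrite E2. replace (dd_v V u (k u v) * dd_u k u v) with (- beta u v) by lra.
    unfold beta. field. exact Ha. }
  (* Time along an integral curve: dt = du / [cu X]. *)
  set (gamma := fun s c => 1 / cu X s (V s c)).
  assert (Sgamma : smooth2_on B gamma).
  { apply smooth2_div; auto.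
    - intros s c HB. now apply N1, HV.
    - now apply smooth2_const.
    - apply (smooth2_comp B D1 (cu X) (fun s _ => s) V); auto using smooth2_fst.
      intros s c HB. now apply HV. }
  assert (SY : smooth2_on B (param_RInt u0 gamma)).
  { apply smooth2_Ck. intros n. apply Ck_param_RInt. now apply smooth2_Ck. }
  exists W, (fun u v => param_RInt u0 gamma u (k u v)), k.
  split; [exact oW|]. split.
  { rewrite <- V0. now apply (mphi u0 v0). }
  split; [intros [u v] Hq; now apply WD1|]. split.
  { apply (smooth2_comp W B (param_RInt u0 gamma) (fun u _ => u) k); auto using smooth2_fst.
    intros u v Huv. now apply HW. }
  split; [exact Sk|]. intros u v Huv. split; [|now apply Hk].
  destruct (HW u v Huv) as [H1 H2].
  assert (E := differentiable_pt_lim_comp (param_RInt u0 gamma) (fun u _ => u) k u v _ _ _ _ _ _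
    (smooth2_differentiable B _ u (k u v) oB SY H1) (differentiable_fst u v)
    (smooth2_differentiable W k u v oW Sk Huv)).
  apply differentiable_dd in E. destruct E as [E1 E2].
  destruct (Hk u v Huv) as [Hk0 _]. unfold lie_derivative in *. rewrite E1, E2.
  replace (dd_u (param_RInt u0 gamma) u (k u v)) with (1 / cu X u v).
  2: { symmetry. apply is_derive_unique. rewrite <- H2 at 1.
       apply (param_RInt_is_derive_u u0 v0 d b gamma); auto. now apply smooth2_Ck. }
  (* The dependence of [x] through [k] contributes a multiple of the derivative of [k] along [X],
     which is zero. *)
  match goal with |- ?l = 1 => replace l with (cu X u v * (1 / cu X u v)
    + dd_v (param_RInt u0 gamma) u (k u v) * (cu X u v * dd_u k u v + cv X u v * dd_v k u v)) by ring end.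
  rewrite Hk0. field. now apply N1, WD1.
Qed.

Lemma rectify D X (u0 v0 : R) : open D -> smooth_vfield D X -> D (u0, v0) ->
  (cu X u0 v0 <> 0 \/ cv X u0 v0 <> 0) ->
  exists (D' : R * R -> Prop) x k, open D' /\ D' (u0, v0) /\ (forall q, D' q -> D q) /\
    smooth2_on D' x /\ smooth2_on D' k /\
    forall u v, D' (u, v) ->
      lie_derivative X x u v = 1 /\ lie_derivative X k u v = 0 /\
      (dd_u k u v <> 0 \/ dd_v k u v <> 0).
Proof.
  intros HD HX Hp [H0|H0].
  - destruct (rectify_transverse D X u0 v0 HD HX Hp H0) as (D' & x & k & H1 & H2 & H3 & H4 & H5 & H6).
    exists D', x, k. do 5 (split; auto). intros u v Huv. destruct (H6 u v Huv) as (? & ? & ?); auto.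
  - set (X' := VField (fun u v => cv X v u) (fun u v => cu X v u)).
    destruct (rectify_transverse (swap D) X' v0 u0) as (D' & x & k & H1 & H2 & H3 & H4 & H5 & H6);
      auto using open_swap.
    { split; apply smooth2_swap; auto; apply HX. }
    exists (swap D'), (fun u v => x v u), (fun u v => k v u).
    split; [now apply open_swap|]. split; [exact H2|].
    split; [intros [u v] Hq; exact (H3 _ Hq)|].
    split; [now apply smooth2_swap|]. split; [now apply smooth2_swap|].
    intros u v Huv. destruct (H6 v u Huv) as (E1 & E2 & E3).
    unfold lie_derivative in *; simpl in E1, E2. rewrite Rplus_comm in E1, E2.
    split; [exact E1|split; [exact E2|left; exact E3]].
Qed.

(** * Integration of systems that are affine in suitable coordinates *)

Lemma is_derive_comp_2d F h1 h2 t lx ly d1 d2 :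
  differentiable_pt_lim F (h1 t) (h2 t) lx ly -> is_derive h1 t d1 -> is_derive h2 t d2 ->
  is_derive (fun t => F (h1 t) (h2 t)) t (lx * d1 + ly * d2).
Proof.
  intros HF H1 H2. apply is_derive_Reals.
  apply derivable_pt_lim_comp_2d; auto; now apply is_derive_Reals.
Qed.

Lemma interval_segment J t0 t s : is_open_interval J -> J t0 -> J t ->
  Rmin t0 t <= s <= Rmax t0 t -> J s.
Proof.
  intros [_ HJ] H0 Ht Hs. unfold Rmin, Rmax in Hs. destruct (Rle_dec t0 t).
  - now apply HJ with t0 t.
  - now apply HJ with t t0.
Qed.

Section LinearEquation.
Variables (J : R -> Prop) (t0 : R) (q r : R -> R).
Hypothesis J_interval : is_open_interval J.
Hypothesis J_t0 : J t0.
Hypothesis q_cont : forall t, J t -> continuous q t.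
Hypothesis r_cont : forall t, J t -> continuous r t.

Lemma ex_RInt_interval (h : R -> R) t : (forall s, J s -> continuous h s) -> J t ->
  ex_RInt h t0 t.
Proof.
  intros Hh Ht. apply @ex_RInt_continuous. intros s Hs. apply Hh.
  now apply interval_segment with t0 t.
Qed.

Lemma is_derive_RInt_open (h : R -> R) t : (forall s, J s -> continuous h s) -> J t ->
  is_derive (fun t => RInt h t0 t) t (h t).
Proof.
  intros Hh Ht. apply is_derive_RInt with t0; [|now apply Hh].
  apply filter_imp with (2 := proj1 J_interval t Ht).
  intros s Hs. apply @RInt_correct. now apply ex_RInt_interval.
Qed.

(** Variation of constants. The exponent is written [0 - RInt q t0 s] because expressions have
    [QSub] but no negation; [qeval_linear_solution] then holds by computation. *)
Definition linear_solution (c t : R) : R :=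
  exp (RInt q t0 t) * (c + RInt (fun s => r s * exp (0 - RInt q t0 s)) t0 t).

Lemma is_derive_exp_neg_RInt t : J t ->
  is_derive (fun t => exp (0 - RInt q t0 t)) t (- q t * exp (0 - RInt q t0 t)).
Proof.
  intros Ht. apply (is_derive_comp exp (fun t => 0 - RInt q t0 t)); [apply is_derive_exp|].
  replace (- q t) with (minus zero (q t)) by (unfold minus, plus, opp, zero; simpl; ring).
  apply @is_derive_minus; [apply @is_derive_const|].
  now apply is_derive_RInt_open.
Qed.

Lemma integrand_continuous t : J t -> continuous (fun s => r s * exp (0 - RInt q t0 s)) t.
Proof.
  intros Ht. apply (continuous_mult r (fun s => exp (0 - RInt q t0 s))); auto.
  apply (ex_derive_continuous (fun s => exp (0 - RInt q t0 s))). eexists.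
  now apply is_derive_exp_neg_RInt.
Qed.

Lemma linear_solution_is_derive c t : J t ->
  is_derive (linear_solution c) t (q t * linear_solution c t + r t).
Proof.
  intros Ht. unfold linear_solution.
  set (E := RInt q t0 t). set (S := RInt (fun s => r s * exp (0 - RInt q t0 s)) t0 t).
  replace (q t * (exp E * (c + S)) + r t)
    with (q t * exp E * (c + S) + exp E * (0 + r t * exp (0 - E))).
  2: { rewrite Rminus_0_l, exp_Ropp. field. apply Rgt_not_eq, exp_pos. }
  apply (Derive.is_derive_mult (fun t => exp (RInt q t0 t))
    (fun t => c + RInt (fun s => r s * exp (0 - RInt q t0 s)) t0 t)).
  - apply (is_derive_comp exp (fun t => RInt q t0 t)); [apply is_derive_exp|].
    now apply is_derive_RInt_open.
  - apply @is_derive_plus; [apply @is_derive_const|].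
    apply (is_derive_RInt_open (fun s => r s * exp (0 - RInt q t0 s))); auto.
    exact integrand_continuous.
Qed.

Lemma linear_solution_unique y :
  (forall t, J t -> is_derive y t (q t * y t + r t)) ->
  forall t, J t -> y t = linear_solution (y t0) t.
Proof.
  intros Hy t Ht.
  (* The difference of two solutions times the integrating factor has zero derivative and vanishes
     at [t0]. *)
  set (h := fun t => (y t - linear_solution (y t0) t) * exp (0 - RInt q t0 t)).
  assert (Hh : forall t, J t -> is_derive h t 0).
  { intros s Hs.
    replace 0 with ((q s * y s + r s - (q s * linear_solution (y t0) s + r s))
        * exp (0 - RInt q t0 s)
      + (y s - linear_solution (y t0) s) * (- q s * exp (0 - RInt q t0 s))) at 1 by ring.
    apply (Derive.is_derive_mult (fun t => y t - linear_solution (y t0) t)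
      (fun t => exp (0 - RInt q t0 t))); [|now apply is_derive_exp_neg_RInt].
    apply @is_derive_minus; [now apply Hy|now apply linear_solution_is_derive]. }
  destruct (MVT_gen h t0 t (fun _ => 0)) as [z [_ Hz]].
  - intros s Hs. apply Hh, interval_segment with t0 t; auto. lra.
  - intros s Hs. apply continuity_pt_filterlim, (ex_derive_continuous h).
    eexists. apply Hh, interval_segment with t0 t; auto.
  - assert (H0 : h t0 = 0).
    { unfold h, linear_solution. rewrite !RInt_point. change (zero : R) with 0.
      rewrite exp_0. ring. }
    rewrite H0 in Hz. unfold h in Hz. assert (He := exp_pos (0 - RInt q t0 t)).
    assert (Hz' : (y t - linear_solution (y t0) t) * exp (0 - RInt q t0 t) = 0) by lra.
    apply Rmult_integral in Hz'. lra.
Qed.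

End LinearEquation.

Definition qlinear (a b : R) : qexpr :=
  QAdd (QMul (QReal a) QCoef1) (QMul (QReal b) QCoef2).

Definition qlinear_solution (q1 q2 r1 r2 : R) (c : qexpr) : qexpr :=
  QMul (QElem EExp (QInt (qlinear q1 q2)))
    (QAdd c (QInt (QMul (qlinear r1 r2) (QElem EExp (QSub (QReal 0) (QInt (qlinear q1 q2))))))).

Lemma qeval_linear_solution f g t0 c1 c2 q1 q2 r1 r2 c t :
  qeval f g t0 c1 c2 (qlinear_solution q1 q2 r1 r2 c) t
  = linear_solution t0 (fun t => q1 * f t + q2 * g t) (fun t => r1 * f t + r2 * g t)
      (qeval f g t0 c1 c2 c t) t.
Proof. reflexivity. Qed.

Lemma continuous_lin (f g : R -> R) a b t : continuous f t -> continuous g t ->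
  continuous (fun t => a * f t + b * g t) t.
Proof.
  intros Hf Hg. apply (continuous_plus (fun t => a * f t) (fun t => b * g t)).
  - apply (continuous_mult (fun _ => a) f); auto. apply continuous_const.
  - apply (continuous_mult (fun _ => b) g); auto. apply continuous_const.
Qed.

Lemma qdefined_linear_solution (J : R -> Prop) f g t0 c1 c2 q1 q2 r1 r2 c t :
  is_open_interval J -> J t0 ->
  (forall t, J t -> continuous f t) -> (forall t, J t -> continuous g t) ->
  qdefined f g t0 c1 c2 c t -> J t ->
  qdefined f g t0 c1 c2 (qlinear_solution q1 q2 r1 r2 c) t.
Proof.
  intros HJ H0 Hf Hg Hc Ht.
  assert (Hq : forall t, J t -> continuous (fun t => q1 * f t + q2 * g t) t)
    by (intros; now apply continuous_lin; auto).
  assert (Hr : forall t, J t -> continuous (fun t => r1 * f t + r2 * g t) t)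
    by (intros; now apply continuous_lin; auto).
  simpl. repeat split; auto; try (intros; apply ex_RInt_interval with J; auto);
    try (now apply interval_segment with t0 t).
  intros s Hs. now apply (integrand_continuous J t0 _ _ HJ H0 Hq Hr).
Qed.

Lemma smooth1_continuous T f t : smooth1_on T f -> T t -> continuous f t.
Proof.
  intros Hf Ht. apply (ex_derive_continuous f). exact (Hf 1%nat t Ht).
Qed.

Definition affine_along (V : R * R -> Prop) (X : vfield) (phi : R -> R -> R) (q r : R) : Prop :=
  forall u v, V (u, v) -> lie_derivative X phi u v = q * phi u v + r.

Lemma general_solution_affine (T : R -> Prop) (U V W : R * R -> Prop)
  (Theta Omega : R -> R -> R -> R) (f g : R -> R) (X1 X2 : vfield) phi1 phi2
  (q11 q12 r11 r12 q21 q22 r21 r22 : R) :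
  smooth1_on T f -> smooth1_on T g ->
  (forall t u v, T t -> U (u, v) -> Theta t u v = f t * cu X1 u v + g t * cu X2 u v) ->
  (forall t u v, T t -> U (u, v) -> Omega t u v = f t * cv X1 u v + g t * cv X2 u v) ->
  (forall q, V q -> U q) -> diffeomorphism V W phi1 phi2 ->
  affine_along V X1 phi1 q11 r11 -> affine_along V X2 phi1 q12 r12 ->
  affine_along V X1 phi2 q21 r21 -> affine_along V X2 phi2 q22 r22 ->
  general_solution f g T Theta Omega V phi1 phi2
    (qlinear_solution q11 q12 r11 r12 QIntConst1) (qlinear_solution q21 q22 r21 r22 QIntConst2).
Proof.
  intros Hf Hg HTh HOm VU (oV & oW & psi1 & psi2 & Sphi1 & Sphi2 & Spsi1 & Spsi2 & mphi & mpsi & Lphi & Lpsi)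
    A11 A12 A21 A22 J t0 HJ JT J0 u v HV.
  assert (Cf : forall t, J t -> continuous f t) by (intros; apply smooth1_continuous with T; auto).
  assert (Cg : forall t, J t -> continuous g t) by (intros; apply smooth1_continuous with T; auto).
  assert (Clin : forall a b t, J t -> continuous (fun t => a * f t + b * g t) t)
    by (intros; apply continuous_lin; auto).
  assert (rate : forall phi q1 q2 r1 r2 t, J t -> affine_along V X1 phi q1 r1 ->
    affine_along V X2 phi q2 r2 ->
    dd_u phi (u t) (v t) * Theta t (u t) (v t) + dd_v phi (u t) (v t) * Omega t (u t) (v t)
    = (q1 * f t + q2 * g t) * phi (u t) (v t) + (r1 * f t + r2 * g t)).
  { intros phi q1 q2 r1 r2 t Ht H1 H2. rewrite HTh, HOm by auto.
    specialize (H1 _ _ (HV t Ht)). specialize (H2 _ _ (HV t Ht)). unfold lie_derivative in *.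
    replace ((q1 * f t + q2 * g t) * phi (u t) (v t) + (r1 * f t + r2 * g t))
      with (f t * (q1 * phi (u t) (v t) + r1) + g t * (q2 * phi (u t) (v t) + r2)) by ring.
    rewrite <- H1, <- H2. ring. }
  split.
  - intros Hsol.
    assert (Hd : forall phi q1 q2 r1 r2, smooth2_on V phi -> affine_along V X1 phi q1 r1 ->
      affine_along V X2 phi q2 r2 -> forall t, J t -> phi (u t) (v t) =
        linear_solution t0 (fun t => q1 * f t + q2 * g t) (fun t => r1 * f t + r2 * g t)
          (phi (u t0) (v t0)) t).
    { intros phi q1 q2 r1 r2 Sphi H1 H2.
      apply (linear_solution_unique J t0 _ _ HJ J0 (Clin q1 q2) (Clin r1 r2)
               (fun t => phi (u t) (v t))).
      intros t Ht. rewrite <- (rate phi q1 q2 r1 r2 t Ht H1 H2).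
      destruct (Hsol t Ht). apply is_derive_comp_2d; auto.
      apply smooth2_differentiable with V; auto. }
    (* All integrals start at [t0], so the constants are the initial coordinates. *)
    exists (phi1 (u t0) (v t0)), (phi2 (u t0) (v t0)). intros t Ht.
    split; [now apply (qdefined_linear_solution J)|].
    split; [now apply (qdefined_linear_solution J)|].
    rewrite !qeval_linear_solution. split; now apply Hd.
  - intros (c1 & c2 & Hc).
    assert (Hd : forall phi q1 q2 r1 r2 c, affine_along V X1 phi q1 r1 ->
      affine_along V X2 phi q2 r2 -> 
      (forall t, J t -> phi (u t) (v t) =
        linear_solution t0 (fun t => q1 * f t + q2 * g t) (fun t => r1 * f t + r2 * g t) c t) ->
      forall t, J t -> is_derive (fun t => phi (u t) (v t)) t
        (dd_u phi (u t) (v t) * Theta t (u t) (v t) + dd_v phi (u t) (v t) * Omega t (u t) (v t))).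
    { intros phi q1 q2 r1 r2 c H1 H2 H t Ht.
      rewrite (rate phi q1 q2 r1 r2 t Ht H1 H2), (H t Ht).
      apply (is_derive_ext_loc (linear_solution t0 (fun t => q1 * f t + q2 * g t)
               (fun t => r1 * f t + r2 * g t) c)).
      - apply filter_imp with (2 := proj1 HJ t Ht). intros s Hs. symmetry. now apply H.
      - now apply (linear_solution_is_derive J t0 _ _ HJ J0 (Clin q1 q2) (Clin r1 r2)). }
    assert (D1 := Hd phi1 q11 q12 r11 r12 c1 A11 A12
      (fun t Ht => proj1 (proj2 (proj2 (Hc t Ht))))).
    assert (D2 := Hd phi2 q21 q22 r21 r22 c2 A21 A22
      (fun t Ht => proj2 (proj2 (proj2 (Hc t Ht))))).
    intros t Ht. assert (HVt := HV t Ht). assert (HWt := mphi _ _ HVt).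
    (* In this direction [u] and [v] are not known to be differentiable. They are recovered as
       components [psi] of the inverse map applied to the differentiable coordinate curves; [pr] is
       the projection in question. *)
    assert (Pu : forall psi (pr : R -> R -> R) lx ly, smooth2_on W psi ->
      differentiable_pt_lim pr (u t) (v t) lx ly ->
      (forall x y, V (x, y) -> psi (phi1 x y) (phi2 x y) = pr x y) ->
      is_derive (fun t => pr (u t) (v t)) t
        (lx * Theta t (u t) (v t) + ly * Omega t (u t) (v t))).
    { intros psi pr lx ly Spsi Hpr E.
      assert (Dpsi := smooth2_differentiable W psi _ _ oW Spsi HWt).
      assert (Dc := differentiable_pt_lim_comp psi phi1 phi2 (u t) (v t) _ _ _ _ _ _ Dpsi
        (smooth2_differentiable V phi1 _ _ oV Sphi1 HVt)
        (smooth2_differentiable V phi2 _ _ oV Sphi2 HVt)).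
      destruct (differentiable_local_unique V _ pr _ _ _ _ _ _ oV HVt E Dc Hpr) as [<- <-].
      apply (is_derive_ext_loc (fun s => psi (phi1 (u s) (v s)) (phi2 (u s) (v s)))).
      { apply filter_imp with (2 := proj1 HJ t Ht). intros s Hs. apply E. now apply HV. }
      assert (Dt := is_derive_comp_2d psi (fun s => phi1 (u s) (v s)) (fun s => phi2 (u s) (v s)) t
        _ _ _ _ Dpsi (D1 t Ht) (D2 t Ht)).
      match type of Dt with is_derive _ _ ?x => match goal with |- is_derive _ _ ?y =>
        replace y with x by ring end end.
      exact Dt. }
    split.
    + replace (Theta t (u t) (v t)) with (1 * Theta t (u t) (v t) + 0 * Omega t (u t) (v t)) by ring.
      apply (Pu psi1 (fun x _ => x)); auto using differentiable_fst.
      intros x y Hxy. now apply Lphi.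
    + replace (Omega t (u t) (v t)) with (0 * Theta t (u t) (v t) + 1 * Omega t (u t) (v t)) by ring.
      apply (Pu psi2 (fun _ y => y)); auto using differentiable_snd.
      intros x y Hxy. now apply Lphi.
Qed.

(** * Local normal forms of a pair with [A, B] = B *)

Lemma differentiable_mult F G u v lx ly mx my :
  differentiable_pt_lim F u v lx ly -> differentiable_pt_lim G u v mx my ->
  differentiable_pt_lim (fun u v => F u v * G u v) u v
    (lx * G u v + F u v * mx) (ly * G u v + F u v * my).
Proof.
  intros HF HG.
  assert (HM : differentiable_pt_lim Rmult (F u v) (G u v) (G u v) (F u v)).
  { apply (differentiable_of_partials (fun _ => True) Rmult (fun _ y => y) (fun x _ => x)); auto.
    - apply open_true.
    - intros x y _. auto_derive; [exact I|ring].
    - intros x y _. auto_derive; [exact I|ring].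
    - apply Ck_snd, open_true. }
  assert (H := differentiable_pt_lim_comp Rmult F G u v _ _ _ _ _ _ HM HF HG).
  rewrite (Rmult_comm lx), (Rmult_comm ly). exact H.
Qed.

Lemma differentiable_minus F G u v lx ly mx my :
  differentiable_pt_lim F u v lx ly -> differentiable_pt_lim G u v mx my ->
  differentiable_pt_lim (fun u v => F u v - G u v) u v (lx - mx) (ly - my).
Proof.
  intros HF HG.
  assert (HM : differentiable_pt_lim Rminus (F u v) (G u v) 1 (-1)).
  { apply (differentiable_of_partials (fun _ => True) Rminus (fun _ _ => 1) (fun _ _ => -1)); auto.
    - apply open_true.
    - intros x y _. auto_derive; [exact I|ring].
    - intros x y _. auto_derive; [exact I|ring].
    - apply Ck_const, open_true. }
  assert (H := differentiable_pt_lim_comp Rminus F G u v _ _ _ _ _ _ HM HF HG).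
  replace (lx - mx) with (1 * lx + -1 * mx) by ring.
  replace (ly - my) with (1 * ly + -1 * my) by ring. exact H.
Qed.

Lemma differentiable_comp_1d h dh F u v lx ly :
  is_derive h (F u v) dh -> differentiable_pt_lim F u v lx ly ->
  differentiable_pt_lim (fun u v => h (F u v)) u v (dh * lx) (dh * ly).
Proof.
  intros Hh HF.
  assert (Hh' : differentiable_pt_lim (fun x _ => h x) (F u v) 0 dh 0).
  { apply differentiable_pt_lim_proj1_0, is_derive_Reals, Hh. }
  assert (Hc : differentiable_pt_lim (fun _ _ => 0) u v 0 0).
  { apply differentiable_pt_lim_proj1_0, derivable_pt_lim_const. }
  assert (H := differentiable_pt_lim_comp (fun x _ => h x) F (fun _ _ => 0) u v _ _ _ _ _ _ Hh' HF Hc).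
  replace (dh * lx) with (dh * lx + 0 * 0) by ring.
  replace (dh * ly) with (dh * ly + 0 * 0) by ring. exact H.
Qed.

Lemma differentiable_exp F u v lx ly : differentiable_pt_lim F u v lx ly ->
  differentiable_pt_lim (fun u v => exp (F u v)) u v (exp (F u v) * lx) (exp (F u v) * ly).
Proof. apply differentiable_comp_1d, is_derive_exp. Qed.

Lemma differentiable_opp F u v lx ly : differentiable_pt_lim F u v lx ly ->
  differentiable_pt_lim (fun u v => - F u v) u v (- lx) (- ly).
Proof.
  intros HF. replace (- lx) with (-1 * lx) by ring. replace (- ly) with (-1 * ly) by ring.
  apply (differentiable_comp_1d Ropp); auto.
  apply (is_derive_opp (fun x : R => x) _ 1), @is_derive_id.
Qed.

Lemma differentiable_inv F u v lx ly : F u v <> 0 -> differentiable_pt_lim F u v lx ly ->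
  differentiable_pt_lim (fun u v => / F u v) u v (- 1 / F u v ^ 2 * lx) (- 1 / F u v ^ 2 * ly).
Proof.
  intros H0. apply (differentiable_comp_1d Rinv).
  apply (is_derive_inv (fun x => x)); auto. apply @is_derive_id.
Qed.

Lemma differentiable_div F G u v lx ly mx my : G u v <> 0 ->
  differentiable_pt_lim F u v lx ly -> differentiable_pt_lim G u v mx my ->
  differentiable_pt_lim (fun u v => F u v / G u v) u v
    ((lx * G u v - F u v * mx) / G u v ^ 2) ((ly * G u v - F u v * my) / G u v ^ 2).
Proof.
  intros H0 HF HG.
  assert (H := differentiable_mult _ _ _ _ _ _ _ _ HF (differentiable_inv _ _ _ _ _ H0 HG)).
  match type of H with differentiable_pt_lim _ _ _ ?x ?y =>
    match goal with |- differentiable_pt_lim _ _ _ ?x' ?y' =>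
      replace x' with x by (field; exact H0); replace y' with y by (field; exact H0) end end.
  exact H.
Qed.

Definition affine_coords (D : R * R -> Prop) (A B : vfield) (p : R * R) : Prop :=
  exists (D' : R * R -> Prop) phi1 phi2,
    (forall q, D' q -> D q) /\ local_coords D' p phi1 phi2 /\
    (exists q r, affine_along D' A phi1 q r) /\ (exists q r, affine_along D' B phi1 q r) /\
    (exists q r, affine_along D' A phi2 q r) /\ (exists q r, affine_along D' B phi2 q r).

(** [X] annihilates dk but not dx, so a nonzero dk cannot be proportional to dx. By Cramer's rule a
    zero Jacobian would give [s] dk = 0. *)
Lemma jacobian_of_lie X x k u v : lie_derivative X x u v <> 0 -> lie_derivative X k u v = 0 ->
  (dd_u k u v <> 0 \/ dd_v k u v <> 0) -> jacobian x k u v <> 0.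
Proof.
  unfold lie_derivative, jacobian. intros Hx Hk H0 HJ.
  set (s := cu X u v * dd_u x u v + cv X u v * dd_v x u v) in *.
  assert (E1 : s * dd_v k u v = 0).
  { replace (s * dd_v k u v) with
      (cu X u v * (dd_u x u v * dd_v k u v - dd_v x u v * dd_u k u v)
       + dd_v x u v * (cu X u v * dd_u k u v + cv X u v * dd_v k u v)) by (unfold s; ring).
    rewrite HJ, Hk. ring. }
  assert (E2 : s * dd_u k u v = 0).
  { replace (s * dd_u k u v) with
      (- cv X u v * (dd_u x u v * dd_v k u v - dd_v x u v * dd_u k u v)
       + dd_u x u v * (cu X u v * dd_u k u v + cv X u v * dd_v k u v)) by (unfold s; ring).
    rewrite HJ, Hk. ring. }
  apply Rmult_integral in E1. apply Rmult_integral in E2. tauto.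
Qed.

Lemma affine_coords_zero D A B p : open D -> D p ->
  (forall u v, D (u, v) -> cu B u v = 0 /\ cv B u v = 0) ->
  (forall u v, D (u, v) -> cu A u v = 0 /\ cv A u v = 0) -> affine_coords D A B p.
Proof.
  intros HD Hp HB HA. exists D, (fun u _ => u), (fun _ v => v).
  split; [auto|]. split; [now apply local_coords_id|].
  repeat split; exists 0, 0; intros u v Huv; unfold lie_derivative;
    destruct (HA u v Huv) as [EA1 EA2], (HB u v Huv) as [EB1 EB2];
    rewrite ?EA1, ?EA2, ?EB1, ?EB2; ring.
Qed.

Lemma affine_coords_B_zero D A B (u0 v0 : R) : open D -> smooth_vfield D A -> D (u0, v0) ->
  (forall u v, D (u, v) -> cu B u v = 0 /\ cv B u v = 0) ->
  (cu A u0 v0 <> 0 \/ cv A u0 v0 <> 0) -> affine_coords D A B (u0, v0).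
Proof.
  intros HD HA Hp HB H0.
  destruct (rectify D A u0 v0 HD HA Hp H0) as (D' & x & k & oD' & Hp' & HD' & Sx & Sk & H).
  exists D', x, k. split; [exact HD'|]. split.
  { apply local_coords_of_jacobian; auto. destruct (H u0 v0 Hp') as (H1 & H2 & H3).
    apply jacobian_of_lie with A; auto. lra. }
  split; [|split; [|split]].
  - exists 0, 1. intros u v Huv. destruct (H u v Huv) as (-> & _). ring.
  - exists 0, 0. intros u v Huv. unfold lie_derivative. destruct (HB u v) as [-> ->]; auto. ring.
  - exists 0, 0. intros u v Huv. destruct (H u v Huv) as (_ & -> & _). ring.
  - exists 0, 0. intros u v Huv. unfold lie_derivative. destruct (HB u v) as [-> ->]; auto. ring.
Qed.

Definition vdet (A B : vfield) (u v : R) : R := cu A u v * cv B u v - cv A u v * cu B u v.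

(* Where A and B are parallel, A = h B, and [h B, B] = - (B h) B. *)
Lemma affine_coords_dependent D A B (u0 v0 : R) : open D ->
  smooth_vfield D A -> smooth_vfield D B -> eq_vfield_on D (bracket A B) B -> D (u0, v0) ->
  (forall u v, D (u, v) -> vdet A B u v = 0) ->
  (cu B u0 v0 <> 0 \/ cv B u0 v0 <> 0) -> affine_coords D A B (u0, v0).
Proof.
  intros HD [SA1 SA2] [SB1 SB2] Hbr Hp Hdet H0.
  set (N := fun u v => cu B u v * cu B u v + cv B u v * cv B u v).
  assert (SN : smooth2_on D N) by (apply smooth2_plus; auto; apply smooth2_mult; auto).
  set (D1 := fun q : R * R => D q /\ N (fst q) (snd q) <> 0).
  assert (oD1 : open D1) by now apply open_nonzero.
  assert (D1D : forall q, D1 q -> D q) by (intros q Hq; apply Hq).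
  (* The factor in A = h B as an orthogonal projection: smooth wherever [B] is nonzero, whichever
     component of [B] that is. *)
  set (h := fun u v => (cu A u v * cu B u v + cv A u v * cv B u v) / N u v).
  assert (SB1' := smooth2_subset _ _ _ D1D SB1). assert (SB2' := smooth2_subset _ _ _ D1D SB2).
  assert (SA1' := smooth2_subset _ _ _ D1D SA1). assert (SA2' := smooth2_subset _ _ _ D1D SA2).
  assert (Sh : smooth2_on D1 h).
  { apply smooth2_div; auto.
    - intros u v Huv. apply Huv.
    - apply smooth2_plus; auto; apply smooth2_mult; auto.
    - now apply smooth2_subset with D. }
  assert (EA : forall u v, D1 (u, v) -> cu A u v = h u v * cu B u v /\ cv A u v = h u v * cv B u v).
  { intros u v [Huv HN]. simpl in HN. specialize (Hdet u v Huv). unfold vdet in Hdet.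
    assert (E : cu A u v * cv B u v = cv A u v * cu B u v) by lra.
    unfold h. split; apply Rmult_eq_reg_r with (N u v); auto.
    - replace ((cu A u v * cu B u v + cv A u v * cv B u v) / N u v * cu B u v * N u v)
        with (cu A u v * cu B u v * cu B u v + cv A u v * cu B u v * cv B u v) by (field; auto).
      rewrite <- E. unfold N. ring.
    - replace ((cu A u v * cu B u v + cv A u v * cv B u v) / N u v * cv B u v * N u v)
        with (cu A u v * cv B u v * cu B u v + cv A u v * cv B u v * cv B u v) by (field; auto).
      rewrite E. unfold N. ring. }
  assert (Bh : forall u v, D1 (u, v) -> lie_derivative B h u v = -1).
  { intros u v Huv. destruct (EA u v Huv) as [E1 E2].
    assert (Dh := smooth2_differentiable D1 h u v oD1 Sh Huv).
    assert (DB1 := smooth2_differentiable D1 _ u v oD1 SB1' Huv).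
    assert (DB2 := smooth2_differentiable D1 _ u v oD1 SB2' Huv).
    assert (DA1 := smooth2_differentiable D1 _ u v oD1 SA1' Huv).
    assert (DA2 := smooth2_differentiable D1 _ u v oD1 SA2' Huv).
    (* The identity A = h B holds on an open set, so it may be differentiated; inserted in the
       bracket it gives ([w] + 1) B = 0. *)
    destruct (differentiable_local_unique D1 (cu A) _ u v _ _ _ _ oD1 Huv
      (fun x y H => proj1 (EA x y H)) DA1 (differentiable_mult _ _ _ _ _ _ _ _ Dh DB1)) as [F1 F2].
    destruct (differentiable_local_unique D1 (cv A) _ u v _ _ _ _ oD1 Huv
      (fun x y H => proj2 (EA x y H)) DA2 (differentiable_mult _ _ _ _ _ _ _ _ Dh DB2)) as [F3 F4].
    destruct (Hbr u v (proj1 Huv)) as [G1 G2]. simpl in G1, G2. unfold lie_derivative in *.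
    rewrite E1, E2, F1, F2 in G1. rewrite E1, E2, F3, F4 in G2.
    set (w := cu B u v * dd_u h u v + cv B u v * dd_v h u v).
    assert (G1' : (w + 1) * cu B u v = 0) by (unfold w; lra).
    assert (G2' : (w + 1) * cv B u v = 0) by (unfold w; lra).
    apply Rmult_integral in G1'. apply Rmult_integral in G2'.
    destruct G1' as [G1'|G1']; [lra|]. destruct G2' as [G2'|G2']; [lra|].
    exfalso. apply (proj2 Huv). simpl. unfold N. rewrite G1', G2'. ring. }
  assert (Hp1 : D1 (u0, v0)).
  { split; auto. simpl. unfold N. assert (Q1 := Rle_0_sqr (cu B u0 v0)).
    assert (Q2 := Rle_0_sqr (cv B u0 v0)). unfold Rsqr in *.
    destruct H0 as [H0|H0]; apply Rsqr_pos_lt in H0; unfold Rsqr in H0; lra. }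
  destruct (rectify D1 B u0 v0 oD1) as (D' & x & k & oD' & Hp' & HD' & _ & Sk & H); auto.
  { now split. }
  assert (lieA : forall F u v, D' (u, v) -> lie_derivative A F u v = h u v * lie_derivative B F u v).
  { intros F u v Huv. destruct (EA u v (HD' _ Huv)) as [E1 E2]. unfold lie_derivative.
    rewrite E1, E2. ring. }
  exists D', h, k. split; [auto|]. split.
  { apply local_coords_of_jacobian; auto.
    - now apply smooth2_subset with D1.
    - destruct (H u0 v0 Hp') as (H1 & H2 & H3).
      apply jacobian_of_lie with B; auto. rewrite Bh; auto. lra. }
  split; [|split; [|split]].
  - exists (-1), 0. intros u v Huv. rewrite lieA, Bh by auto. ring.
  - exists 0, (-1). intros u v Huv. rewrite Bh by auto. ring.
  - exists 0, 0. intros u v Huv. rewrite lieA by auto. destruct (H u v Huv) as (_ & -> & _). ring.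
  - exists 0, 0. intros u v Huv. destruct (H u v Huv) as (_ & -> & _). ring.
Qed.

(* For the coframe (alpha, beta) dual to (A, B), [A, B] = B means that alpha and
   exp x * beta are closed, where alpha = dx; if exp x * beta = dw then
   (x, exp (- x) * w) are the coordinates of the model system. *)
Lemma affine_coords_independent D A B (u0 v0 : R) : open D ->
  smooth_vfield D A -> smooth_vfield D B -> eq_vfield_on D (bracket A B) B -> D (u0, v0) ->
  vdet A B u0 v0 <> 0 -> affine_coords D A B (u0, v0).
Proof.
  intros HD [SA1 SA2] [SB1 SB2] Hbr Hp H0.
  assert (Sdet : smooth2_on D (vdet A B)).
  { apply smooth2_Ck. intros n. apply Ck_minus; auto; apply Ck_mult; auto; now apply smooth2_Ck. }
  destruct (open_locally_2d _ u0 v0 (open_nonzero D (vdet A B) HD Sdet)) as [e He].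
  { now split. }
  set (E := box u0 v0 e e). assert (oE : open E) by apply open_box.
  assert (Ep : E (u0, v0)) by (split; simpl; rewrite Rminus_diag, Rabs_R0; apply cond_pos).
  assert (ED : forall q, E q -> D q) by (intros [u v] [H1 H2]; now apply He).
  assert (Edet : forall u v, E (u, v) -> vdet A B u v <> 0) by (intros u v [H1 H2]; now apply He).
  assert (SB1' := smooth2_subset _ _ _ ED SB1). assert (SB2' := smooth2_subset _ _ _ ED SB2).
  assert (SA1' := smooth2_subset _ _ _ ED SA1). assert (SA2' := smooth2_subset _ _ _ ED SA2).
  assert (Sdet' := smooth2_subset _ _ _ ED Sdet).
  assert (Sopp : forall F, smooth2_on E F -> smooth2_on E (fun u v => - F u v)).
  { intros F HF. apply smooth2_Ck. intros n. apply Ck_opp; auto. now apply smooth2_Ck. }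
  assert (Sexp : forall F, smooth2_on E F -> smooth2_on E (fun u v => exp (F u v))).
  { intros F HF. apply smooth2_Ck. intros n. apply Ck_exp; auto. now apply smooth2_Ck. }
  assert (Ddet : forall u v, E (u, v) -> differentiable_pt_lim (vdet A B) u v
     (dd_u (cu A) u v * cv B u v + cu A u v * dd_u (cv B) u v
      - (dd_u (cv A) u v * cu B u v + cv A u v * dd_u (cu B) u v))
     (dd_v (cu A) u v * cv B u v + cu A u v * dd_v (cv B) u v
      - (dd_v (cv A) u v * cu B u v + cv A u v * dd_v (cu B) u v))).
  { intros u v Huv. apply differentiable_minus; apply differentiable_mult;
      now apply smooth2_differentiable with E. }
  (* The form alpha with alpha(A) = 1, alpha(B) = 0. Its closedness amounts to det([A, B], B) = 0,
     which is [Z]. *)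
  destruct (poincare u0 v0 e e (fun u v => cv B u v / vdet A B u v)
             (fun u v => (- cu B u v) / vdet A B u v)) as (x & Sx & Dx); auto.
  { apply smooth2_div; auto. }
  { apply smooth2_div; auto. }
  { intros u v Huv. assert (Hd := Edet u v Huv). destruct (Hbr u v (ED _ Huv)) as [G1 G2].
    assert (DB1 := smooth2_differentiable E _ u v oE SB1' Huv).
    assert (DB2 := smooth2_differentiable E _ u v oE SB2' Huv).
    assert (K1 := differentiable_div _ _ _ _ _ _ _ _ Hd DB2 (Ddet u v Huv)).
    assert (K2 := differentiable_div _ _ _ _ _ _ _ _ Hd (differentiable_opp _ _ _ _ _ DB1) (Ddet u v Huv)).
    apply differentiable_dd in K1. apply differentiable_dd in K2.
    destruct K1 as [_ ->], K2 as [-> _].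
    unfold Rdiv. f_equal. unfold vdet in *. simpl in G1, G2. unfold lie_derivative in *.
    assert (Z : (cu A u v * dd_u (cu B) u v + cv A u v * dd_v (cu B) u v -
       (cu B u v * dd_u (cu A) u v + cv B u v * dd_v (cu A) u v)) * cv B u v
      - (cu A u v * dd_u (cv B) u v + cv A u v * dd_v (cv B) u v -
       (cu B u v * dd_u (cv A) u v + cv B u v * dd_v (cv A) u v)) * cu B u v = 0).
    { rewrite G1, G2. ring. }
    apply Rminus_diag_uniq. etransitivity; [|exact Z]. ring. }
  (* The form beta with beta(A) = 0, beta(B) = 1, scaled by [exp x]. Differentiating that factor
     contributes [- d], which cancels the term from det([A, B], A) = - det(A, B), that is [Z1]. *)
  destruct (poincare u0 v0 e e (fun u v => exp (x u v) * (- cv A u v / vdet A B u v))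
             (fun u v => exp (x u v) * (cu A u v / vdet A B u v))) as (w & Sw & Dw); auto.
  { apply smooth2_mult; auto. apply smooth2_div; auto. }
  { apply smooth2_mult; auto. apply smooth2_div; auto. }
  { intros u v Huv. assert (Hd := Edet u v Huv). destruct (Hbr u v (ED _ Huv)) as [G1 G2].
    assert (DA1 := smooth2_differentiable E _ u v oE SA1' Huv).
    assert (DA2 := smooth2_differentiable E _ u v oE SA2' Huv).
    assert (De := differentiable_exp _ _ _ _ _ (Dx u v Huv)).
    assert (K1 := differentiable_mult _ _ _ _ _ _ _ _ De
       (differentiable_div _ _ _ _ _ _ _ _ Hd (differentiable_opp _ _ _ _ _ DA2) (Ddet u v Huv))).
    assert (K2 := differentiable_mult _ _ _ _ _ _ _ _ De
       (differentiable_div _ _ _ _ _ _ _ _ Hd DA1 (Ddet u v Huv))).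
    apply differentiable_dd in K1. apply differentiable_dd in K2.
    destruct K1 as [_ ->], K2 as [-> _].
    apply Rminus_diag_uniq.
    simpl in G1, G2. unfold lie_derivative in *.
    assert (Z1 : (cu A u v * dd_u (cu B) u v + cv A u v * dd_v (cu B) u v -
       (cu B u v * dd_u (cu A) u v + cv B u v * dd_v (cu A) u v)) * cv A u v
      - (cu A u v * dd_u (cv B) u v + cv A u v * dd_v (cv B) u v -
       (cu B u v * dd_u (cv A) u v + cv B u v * dd_v (cv A) u v)) * cu A u v = - vdet A B u v).
    { rewrite G1, G2. unfold vdet. ring. }
    set (d := vdet A B u v) in *.
    match goal with |- ?l = 0 => replace l with (exp (x u v) / d ^ 2 *
      (- ((cu A u v * dd_u (cu B) u v + cv A u v * dd_v (cu B) u v -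
       (cu B u v * dd_u (cu A) u v + cv B u v * dd_v (cu A) u v)) * cv A u v
      - (cu A u v * dd_u (cv B) u v + cv A u v * dd_v (cv B) u v -
       (cu B u v * dd_u (cv A) u v + cv B u v * dd_v (cv A) u v)) * cu A u v) - d)) end.
    - rewrite Z1. field. exact Hd.
    - unfold d, vdet in *. field. exact Hd. }
  set (y := fun u v => exp (- x u v) * w u v).
  assert (Dy : forall u v, E (u, v) -> differentiable_pt_lim y u v
    (- (cv B u v / vdet A B u v) * y u v + exp (- x u v) * (exp (x u v) * (- cv A u v / vdet A B u v)))
    (- (- cu B u v / vdet A B u v) * y u v + exp (- x u v) * (exp (x u v) * (cu A u v / vdet A B u v)))).
  { intros u v Huv.
    assert (K := differentiable_mult _ _ _ _ _ _ _ _
      (differentiable_exp _ _ _ _ _ (differentiable_opp _ _ _ _ _ (Dx u v Huv))) (Dw u v Huv)).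
    match type of K with differentiable_pt_lim _ _ _ ?a ?b =>
    match goal with |- differentiable_pt_lim _ _ _ ?a' ?b' =>
      replace a' with a by (unfold y; ring); replace b' with b by (unfold y; ring) end end.
    exact K. }
  assert (L : forall u v, E (u, v) -> lie_derivative A x u v = 1 /\ lie_derivative B x u v = 0 /\
     lie_derivative A y u v = - y u v /\ lie_derivative B y u v = 1).
  { intros u v Huv. unfold lie_derivative.
    destruct (differentiable_dd _ _ _ _ _ (Dx u v Huv)) as [-> ->].
    destruct (differentiable_dd _ _ _ _ _ (Dy u v Huv)) as [-> ->].
    assert (Hd := Edet u v Huv). unfold vdet in *. rewrite exp_Ropp.
    assert (He0 := Rgt_not_eq _ _ (exp_pos (x u v))).
    repeat split; field; auto. }
  exists E, x, y. split; [exact ED|]. split.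
  { apply local_coords_of_jacobian; auto.
    - apply smooth2_mult; auto.
    - destruct (L u0 v0 Ep) as (L1 & L2 & L3 & L4). intros HJ.
      (* Multiplicativity of determinants; the right-hand side is 1. *)
      assert (Z : jacobian x y u0 v0 * vdet A B u0 v0 = lie_derivative A x u0 v0 * lie_derivative B y u0 v0
        - lie_derivative B x u0 v0 * lie_derivative A y u0 v0)
        by (unfold jacobian, vdet, lie_derivative; ring).
      rewrite HJ, L1, L2, L4 in Z. lra. }
  split; [|split; [|split]].
  - exists 0, 1. intros u v Huv. destruct (L u v Huv) as (-> & _). ring.
  - exists 0, 0. intros u v Huv. destruct (L u v Huv) as (_ & -> & _). ring.
  - exists (-1), 0. intros u v Huv. destruct (L u v Huv) as (_ & _ & -> & _). ring.
  - exists 0, 1. intros u v Huv. destruct (L u v Huv) as (_ & _ & _ & ->). ring.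
Qed.

(** Each condition that holds nowhere in [D] is an identity on [D], exactly the hypothesis of the
    next case. Since [D] can be any small neighbourhood of [q], this yields density. *)
Lemma affine_coords_dense D A B q : open D -> smooth_vfield D A -> smooth_vfield D B ->
  eq_vfield_on D (bracket A B) B -> D q -> exists p, D p /\ affine_coords D A B p.
Proof.
  intros HD SA SB Hbr Hq.
  destruct (classic (exists p, D p /\ vdet A B (fst p) (snd p) <> 0)) as [([u v] & Hp & H)|Hdet].
  { exists (u, v). split; auto. now apply affine_coords_independent. }
  assert (Hdet' : forall u v, D (u, v) -> vdet A B u v = 0).
  { intros u v Huv. apply NNPP. intros H. apply Hdet. now exists (u, v). }
  destruct (classic (exists p, D p /\ (cu B (fst p) (snd p) <> 0 \/ cv B (fst p) (snd p) <> 0)))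
    as [([u v] & Hp & H)|HB].
  { exists (u, v). split; auto. now apply affine_coords_dependent. }
  assert (HB' : forall u v, D (u, v) -> cu B u v = 0 /\ cv B u v = 0).
  { intros u v Huv. split; apply NNPP; intros H; apply HB; exists (u, v); auto. }
  destruct (classic (exists p, D p /\ (cu A (fst p) (snd p) <> 0 \/ cv A (fst p) (snd p) <> 0)))
    as [([u v] & Hp & H)|HA].
  { exists (u, v). split; auto. now apply affine_coords_B_zero. }
  exists q. split; auto. apply affine_coords_zero; auto.
  intros u v Huv. split; apply NNPP; intros H; apply HA; exists (u, v); auto.
Qed.

(** * Passage between the pair A, B and the given fields *)

Lemma bracket_lin_comb D X Y a1 a2 b1 b2 : smooth_vfield D X -> smooth_vfield D Y ->
  eq_vfield_on D (bracket (lin_comb a1 X a2 Y) (lin_comb b1 X b2 Y))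
    (lin_comb (a1 * b2 - a2 * b1) (bracket X Y) 0 zero_vfield).
Proof.
  intros [SX1 SX2] [SY1 SY2] u v Huv.
  assert (Lu : forall a b F G, smooth2_on D F -> smooth2_on D G ->
    dd_u (fun u v => a * F u v + b * G u v) u v = a * dd_u F u v + b * dd_u G u v).
  { intros a b F G HF HG. apply is_derive_unique.
    apply @is_derive_plus; apply is_derive_scal; apply (Ck_is_derive_u 0 D); auto;
      now apply smooth2_Ck. }
  assert (Lv : forall a b F G, smooth2_on D F -> smooth2_on D G ->
    dd_v (fun u v => a * F u v + b * G u v) u v = a * dd_v F u v + b * dd_v G u v).
  { intros a b F G HF HG. apply is_derive_unique.
    apply @is_derive_plus; apply is_derive_scal; [apply (Ck_is_derive_v 0 D F u v)|
      apply (Ck_is_derive_v 0 D G u v)]; auto; now apply smooth2_Ck. }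
  simpl. unfold lie_derivative; simpl. rewrite !Lu, !Lv by assumption. split; ring.
Qed.

Lemma smooth_vfield_lin_comb D a X b Y : open D -> smooth_vfield D X -> smooth_vfield D Y ->
  smooth_vfield D (lin_comb a X b Y).
Proof.
  intros HD [SX1 SX2] [SY1 SY2].
  split; apply smooth2_plus; auto; apply smooth2_mult; auto using smooth2_const.
Qed.

Lemma smooth_vfield_subset (D D' : R * R -> Prop) X : (forall q, D' q -> D q) ->
  smooth_vfield D X -> smooth_vfield D' X.
Proof. intros H [S1 S2]. split; now apply smooth2_subset with D. Qed.

(* The weights [a1], [a2] are those of A in [X1], [X2], chosen so that [A, B] = [X1, X2] = B. *)
Lemma solvable_of_affine_coords (T : R -> Prop) (U : R * R -> Prop)
  (Theta Omega : R -> R -> R -> R) (f g : R -> R) (X1 X2 : vfield) (lambda mu a1 a2 : R) p :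
  smooth1_on T f -> smooth1_on T g ->
  (forall t u v, T t -> U (u, v) -> Theta t u v = f t * cu X1 u v + g t * cu X2 u v) ->
  (forall t u v, T t -> U (u, v) -> Omega t u v = f t * cv X1 u v + g t * cv X2 u v) ->
  a1 * mu - a2 * lambda = 1 ->
  affine_coords U (lin_comb a1 X1 a2 X2) (lin_comb lambda X1 mu X2) p ->
  solvable_by_quadratures_at f g T U Theta Omega p.
Proof.
  intros Hf Hg HTh HOm Ha (D' & phi1 & phi2 & HD' & (V & W & Vp & VD' & HVW)
    & (qA1 & rA1 & HA1) & (qB1 & rB1 & HB1) & (qA2 & rA2 & HA2) & (qB2 & rB2 & HB2)).
  (* Cramer's rule with determinant 1: X1 = mu A - a2 B and X2 = a1 B - lambda A. *)
  assert (E1 : forall phi qA rA qB rB,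
    affine_along D' (lin_comb a1 X1 a2 X2) phi qA rA ->
    affine_along D' (lin_comb lambda X1 mu X2) phi qB rB ->
    affine_along V X1 phi (mu * qA - a2 * qB) (mu * rA - a2 * rB)).
  { intros phi qA rA qB rB HA HB u v Huv.
    specialize (HA u v (VD' _ Huv)). specialize (HB u v (VD' _ Huv)).
    replace ((mu * qA - a2 * qB) * phi u v + (mu * rA - a2 * rB))
      with (mu * (qA * phi u v + rA) - a2 * (qB * phi u v + rB)) by ring.
    rewrite <- HA, <- HB, <- (Rmult_1_l (lie_derivative X1 phi u v)), <- Ha.
    unfold lie_derivative; simpl; ring. }
  assert (E2 : forall phi qA rA qB rB,
    affine_along D' (lin_comb a1 X1 a2 X2) phi qA rA ->
    affine_along D' (lin_comb lambda X1 mu X2) phi qB rB ->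
    affine_along V X2 phi (a1 * qB - lambda * qA) (a1 * rB - lambda * rA)).
  { intros phi qA rA qB rB HA HB u v Huv.
    specialize (HA u v (VD' _ Huv)). specialize (HB u v (VD' _ Huv)).
    replace ((a1 * qB - lambda * qA) * phi u v + (a1 * rB - lambda * rA))
      with (a1 * (qB * phi u v + rB) - lambda * (qA * phi u v + rA)) by ring.
    rewrite <- HA, <- HB, <- (Rmult_1_l (lie_derivative X2 phi u v)), <- Ha.
    unfold lie_derivative; simpl; ring. }
  exists V, W, phi1, phi2. do 2 eexists.
  split; [exact Vp|]. split; [auto|]. split; [exact HVW|].
  apply (general_solution_affine T U V W Theta Omega f g X1 X2 phi1 phi2) with (9 := E1 _ _ _ _ _ HA2 HB2)
    (10 := E2 _ _ _ _ _ HA2 HB2) (7 := E1 _ _ _ _ _ HA1 HB1) (8 := E2 _ _ _ _ _ HA1 HB1); auto.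
Qed.

Theorem proposition2p1
  (T : R -> Prop) (U : R * R -> Prop)
  (Theta Omega : R -> R -> R -> R)
  (f g : R -> R) (X1 X2 : vfield) (lambda mu : R)
  (hT : is_open_interval T) (hU : open U)
  (hf : smooth1_on T f) (hg : smooth1_on T g)
  (hX1 : smooth_vfield U X1) (hX2 : smooth_vfield U X2)
  (hTheta : forall t u v, T t -> U (u, v) ->
     Theta t u v = f t * cu X1 u v + g t * cu X2 u v)
  (hOmega : forall t u v, T t -> U (u, v) ->
     Omega t u v = f t * cv X1 u v + g t * cv X2 u v)
  (hbracket : eq_vfield_on U (bracket X1 X2) (lin_comb lambda X1 mu X2))
  (hnonzero : ~ eq_vfield_on U (bracket X1 X2) zero_vfield) :
  solvable_by_quadratures f g T U Theta Omega.
Proof.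
  assert (Ha : exists a1 a2, a1 * mu - a2 * lambda = 1).
  { destruct (Req_dec mu 0) as [Hm|Hm]; [destruct (Req_dec lambda 0) as [Hl|Hl]|].
    - exfalso. apply hnonzero. intros u v Huv. destruct (hbracket u v Huv) as [-> ->].
      simpl. rewrite Hm, Hl. split; ring.
    - exists 0, (- / lambda). now field.
    - exists (/ mu), 0. now field. }
  destruct Ha as (a1 & a2 & Ha).
  set (A := lin_comb a1 X1 a2 X2). set (B := lin_comb lambda X1 mu X2).
  assert (SA : smooth_vfield U A) by now apply smooth_vfield_lin_comb.
  assert (SB : smooth_vfield U B) by now apply smooth_vfield_lin_comb.
  assert (Hbr : eq_vfield_on U (bracket A B) B).
  { intros u v Huv. destruct (hbracket u v Huv) as [H1 H2].
    destruct (bracket_lin_comb U X1 X2 a1 a2 lambda mu hX1 hX2 u v Huv) as [G1 G2].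
    unfold A, B. rewrite G1, G2. cbn [cu cv lin_comb zero_vfield]. rewrite Ha, H1, H2.
    simpl. split; ring. }
  (* The set of all solvable points itself; it is open because a chart around one point serves all
     points of its domain. *)
  exists (solvable_by_quadratures_at f g T U Theta Omega).
  split; [|split; [|split; [|auto]]].
  - intros p (V & W & phi1 & phi2 & e1 & e2 & Vp & VU & HVW & Hsol).
    apply filter_imp with (2 := proj1 HVW p Vp). intros q Vq.
    now exists V, W, phi1, phi2, e1, e2.
  - intros p (V & W & phi1 & phi2 & e1 & e2 & Vp & VU & _). auto.
  - intros [u0 v0] Hq eps.
    (* Confining the search to a box of half-width [eps] makes the point found [eps]-close; its
       coordinates are then used over [U]. *)
    set (D := fun q => U q /\ box u0 v0 eps eps q).
    assert (oD : open D) by (apply open_and; [exact hU|apply open_box]).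
    assert (DU : forall q, D q -> U q) by (intros q Dq; apply Dq).
    destruct (affine_coords_dense D A B (u0, v0)) as (p & Dp & Hp); auto.
    + now apply smooth_vfield_subset with U.
    + now apply smooth_vfield_subset with U.
    + intros u v Huv. apply Hbr. auto.
    + split; [exact Hq|]. split; simpl; rewrite Rminus_diag, Rabs_R0; apply cond_pos.
    + exists p. split; [|exact (proj2 Dp)].
      apply (solvable_of_affine_coords T U Theta Omega f g X1 X2 lambda mu a1 a2); auto.
      destruct Hp as (D' & phi1 & phi2 & HD' & Hrest).
      exists D', phi1, phi2. split; [auto|exact Hrest].
Qed.
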